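(* Let $n,d\ge 1$ be integers and let $X_1,\dots,X_n$ be random row vectors in $\mathbb R^d$ (with arbitrary joint distribution) satisfying the orthant symmetry condition. Let $R=(R^2)^{1/2}\ge 0$, where $R^2$ is the statistic defined in the context. Then for every $f\in C^2_{\uparrow,conv}$ $$\mathbf E f(n^{1/2}R)\le\mathbf E f(\chi_d).$$
   Context: Orthant symmetry condition: $(X_1,\dots,X_n)$ has the same joint distribution as $(\epsilon_1X_1,\dots,\epsilon_nX_n)$, where $\epsilon_1,\dots,\epsilon_n$ are i.i.d., independent of $(X_1,\dots,X_n)$, with $\mathbf P(\epsilon_i=1)=\mathbf P(\epsilon_i=-1)=\frac12$. Statistic: $\overline X=\frac1n\sum_{i=1}^nX_i$, $S=\frac1n\sum_{i=1}^nX_i^TX_i$ (a $d\times d$ matrix), and $R^2=\lim_{\varepsilon\downarrow0}\overline X(S+\varepsilon I)^{-1}\overline X^T$ (the limit always exists). Equivalently, $nR^2=\nu^TP\nu$, where $\nu=(1,\dots,1)^T\in\mathbb R^n$ and $P$ is the matrix of the orthogonal projector of $\mathbb R^n$ onto the column space of the $n\times d$ matrix whose $i$th row is $X_i$. $\chi_d$ denotes the nonnegative square root of a random variable having the chi-square distribution with $d$ degrees of freedom. $C^2_{conv}$ is the class of all even functions $f:\mathbb R\to\mathbb R$ having a finite and convex second derivative $f''$ on $\mathbb R$. $C^2_{\uparrow,conv}$ is the class of all $f\in C^2_{conv}$ with $f(0)\ge0$ and $f''(0)\ge0$ (equivalently, those $f\in C^2_{conv}$ that are nonnegative and non-decreasing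 on $[0,\infty)$). The right-hand side may be $+\infty$. *)

(* Defs.v *)
From HB Require Import structures.
From mathcomp Require Import all_boot all_order all_algebra.
From mathcomp Require Import all_classical all_reals all_analysis.
Set Implicit Arguments.
Unset Strict Implicit.
Unset Printing Implicit Defensive.
Import Order.TTheory GRing.Theory Num.Theory.
Import numFieldNormedType.Exports.
Local Open Scope classical_set_scope.
Local Open Scope ring_scope.

Definition measure_matrix_display : measure_display -> measure_display.
Proof. exact. Qed.

(* Product sigma-algebra on matrices: the one generated by the entries. For
   real entries it is the Borel sigma-algebra, and it covers both row vectors
   and n-tuples of row vectors (stacked as the rows of a matrix). *)
Section measurable_matrix.
Context {disp : measure_display} {T : measurableType disp}.
Variables m n : nat.

Definition matrix_measurable : set (set 'M[T]_(m, n)) :=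
  <<s \bigcup_(ij in [set: 'I_m * 'I_n])
        preimage_set_system setT (fun M : 'M[T]_(m, n) => M ij.1 ij.2)
                            measurable >>.

Let matrix_set0 : matrix_measurable set0.
Proof. exact: sigma_algebra0. Qed.

Let matrix_setC A : matrix_measurable A -> matrix_measurable (~` A).
Proof. exact: sigma_algebraC. Qed.

Let matrix_bigcup (F : (set 'M[T]_(m, n))^nat) :
  (forall i, matrix_measurable (F i)) -> matrix_measurable (\bigcup_i F i).
Proof. exact: sigma_algebra_bigcup. Qed.

HB.instance Definition _ := @isMeasurable.Build (measure_matrix_display disp)
  'M[T]_(m, n) matrix_measurable matrix_set0 matrix_setC matrix_bigcup.

End measurable_matrix.

Section laws.
Context {R : realType}.

Definition same_law {d1 d2 d3} {T1 : measurableType d1} {T2 : measurableType d2}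
    {U : measurableType d3} (P : probability T1 R) (Q : probability T2 R)
    (f : T1 -> U) (g : T2 -> U) : Prop :=
  forall B : set U, measurable B -> P (f @^-1` B) = Q (g @^-1` B).

Definition independent {d1 d2 d3} {T : measurableType d1}
    {U : measurableType d2} {V : measurableType d3} (P : probability T R)
    (f : T -> U) (g : T -> V) : Prop :=
  forall (A : set U) (B : set V), measurable A -> measurable B ->
    (P ((f @^-1` A) `&` (g @^-1` B)) = P (f @^-1` A) * P (g @^-1` B))%E.

Definition mutually_independent {d1 d2} {T : measurableType d1}
    {U : measurableType d2} (P : probability T R) (I : finType)
    (f : I -> T -> U) : Prop :=
  forall (J : {set I}) (A : I -> set U), (forall i, measurable (A i)) ->
    P (\bigcap_(i in [set` J]) (f i @^-1` A i)) =
      (\prod_(i in J) P (f i @^-1` A i))%E.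

Definition fair_sign {disp} {T : measurableType disp} (P : probability T R)
    (e : T -> R) : Prop :=
  P (e @^-1` [set 1]) = (2^-1)%:E /\ P (e @^-1` [set -1]) = (2^-1)%:E.

(* The signs, being independent of X, live in general on an extension of the
   original probability space: they are taken on a space carrying a copy Y of
   X, i.e. a family with the same joint law. *)
Definition orthant_symmetric {disp} {T : measurableType disp}
    (P : probability T R) (n d : nat) (X : 'I_n -> {RV P >-> 'rV[R]_d}) : Prop :=
  exists (disp' : measure_display) (T' : measurableType disp')
    (Q : probability T' R) (Y : 'I_n -> {RV Q >-> 'rV[R]_d})
    (eps : 'I_n -> {RV Q >-> R}),
  [/\ same_law P Q (fun w => \matrix_(i < n) X i w)
                   (fun w => \matrix_(i < n) Y i w),
      forall i, fair_sign Q (eps i),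
      mutually_independent Q (fun i => eps i : T' -> R),
      independent Q (fun w => \row_(i < n) eps i w)
                    (fun w => \matrix_(i < n) Y i w) &
      same_law P Q (fun w => \matrix_(i < n) X i w)
                   (fun w => \matrix_(i < n) (eps i w *: Y i w))].

Definition chi_square {disp} {T : measurableType disp} (P : probability T R)
    (d : nat) (Y : {RV P >-> R}) : Prop :=
  exists (disp' : measure_display) (T' : measurableType disp')
    (Q : probability T' R) (Z : 'I_d -> {RV Q >-> R}),
  [/\ forall i (B : set R), measurable B ->
        distribution Q (Z i) B = normal_prob 0 1 B,
      mutually_independent Q (fun i => Z i : T' -> R) &
      same_law P Q Y (fun w => \sum_(i < d) Z i w ^+ 2)].

End laws.

Section statistic.
Context {R : realType} (n d : nat).
Implicit Type x : 'I_n -> 'rV[R]_d.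

Definition sample_mean x : 'rV[R]_d := n%:R^-1 *: \sum_(i < n) x i.

Definition sample_second_moment x : 'M[R]_d :=
  n%:R^-1 *: \sum_(i < n) (x i)^T *m x i.

Definition Rsquare x : R :=
  lim ((sample_mean x *m invmx (sample_second_moment x + e%:M)
          *m (sample_mean x)^T) 0 0 @[e --> (0 : R)^'+]).

Definition Rstat x : R := Num.sqrt (Rsquare x).

End statistic.

Section function_classes.
Context {R : realType}.

Definition C2_conv (f : R -> R) : Prop :=
  [/\ forall x, f (- x) = f x,
      forall x, derivable f x 1,
      forall x, derivable (derive1 f) x 1 &
      convex_function [set: convex_lmodType R^o] (derive1n 2 f)].

Definition C2_up_conv (f : R -> R) : Prop :=
  [/\ C2_conv f, 0 <= f 0 & 0 <= (derive1n 2 f) 0].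

End function_classes.

(* Main.v *)
Require Import Defs.
From HB Require Import structures.
From mathcomp Require Import all_boot all_order all_algebra.
From mathcomp Require Import all_classical all_reals all_analysis.
From mathcomp Require Import measurable_realfun.
From mathcomp Require Import ring lra.
Set Implicit Arguments.
Unset Strict Implicit.
Unset Printing Implicit Defensive.
Import Order.TTheory GRing.Theory Num.Theory.
Import numFieldNormedType.Exports.
Local Open Scope classical_set_scope.
Local Open Scope ring_scope.

(** Why the theorem is true.

    Replace S by S + e I with e > 0. With y = X_1 + ... + X_n and
    M = sum X_i^T X_i + n e I, the regularized n R^2 is the quadratic form
    y M^-1 y^T, which increases to n R^2 as e decreases to 0. By monotone
    convergence it suffices to bound E f(sqrt(y M^-1 y^T)) for each e
    ([orthant_symmetric_ridge_le]). By orthant symmetry the rows X_i may be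
    replaced by eps_i X_i; this does not change M, and conditionally on the X_i
    there remains a sum of fixed vectors x_i with random signs, evaluated by
    h(y) = f(sqrt(y M^-1 y^T)).

    From signs to normal variables. The signs are replaced one at a time by
    standard normal variables g, as in the Lindeberg method
    ([sign_average_le_gauss_smooth]). Each replacement increases the
    expectation: h(x + t v) + h(x - t v) is a convex function of t^2, hence lies
    above a tangent a + K (t^2 - 1) touching it at t = 1, and E g^2 = 1
    ([normal_sqr_jensen]). On the line x + t v the quadratic form is
    u^2 + c^2 for an affine function u of t, so the convexity concerns
    phi(u) = f(sqrt(u^2 + c^2)): it says that (phi'(a + t) - phi'(a - t)) / t is
    nondecreasing in t > 0, and this holds because the third derivative of phi
    is nondecreasing ([radial_sym_slope]). As f has only two derivatives, that
    argument is applied with f' replaced by the symmetric difference quotients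
    of f, which are twice differentiable, and the resulting inequality passes
    to the limit ([derive_sym_slope]).

    From normal variables to chi_d. The law of g_1 x_1 + ... + g_n x_n depends
    only on the Gram matrix sum x_i^T x_i: the normal law of the plane is
    invariant under rotations ([normal_rotation]), and rotating pairs of vectors
    reduces x_1, ..., x_n to at most d vectors w_j with the same Gram matrix
    ([gauss_reduce]). For y = sum g_j w_j one has y M^-1 y^T <= sum g_j^2
    ([ridge_le_sqr]). Since f is nondecreasing on the nonnegative reals, the
    expectation is at most E f(chi_k) for some k <= d, hence at most
    E f(chi_d). *)

(** * Derivatives and monotonicity *)

Section derivatives.
Context {R : realType}.
Implicit Types (f g : R -> R) (x a b : R).

Lemma deriveM_fun f g x a b : is_derive x 1 f a -> is_derive x 1 g b ->
  is_derive x 1 (fun y : R => f y * g y) (a * g x + f x * b).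
Proof.
move=> hf hg; apply: (is_derive_eq (is_deriveM hf hg)).
by rewrite /GRing.scale /=; ring.
Qed.

Lemma deriveD_fun f g x a b : is_derive x 1 f a -> is_derive x 1 g b ->
  is_derive x 1 (fun y : R => f y + g y) (a + b).
Proof. by move=> hf hg; exact: (is_deriveD hf hg). Qed.

Lemma deriveN_fun f x a : is_derive x 1 f a ->
  is_derive x 1 (fun y : R => - f y) (- a).
Proof. by move=> hf; exact: (is_deriveN hf). Qed.

Lemma deriveB_fun f g x a b : is_derive x 1 f a -> is_derive x 1 g b ->
  is_derive x 1 (fun y : R => f y - g y) (a - b).
Proof. by move=> hf hg; exact: (is_deriveB hf hg). Qed.

Lemma derive_comp_fun f g x a b : is_derive x 1 g b -> is_derive (g x) 1 f a ->
  is_derive x 1 (fun y : R => f (g y)) (a * b).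
Proof. by move=> hg hf; exact: is_derive1_comp. Qed.

Lemma deriveV_fun f x a : f x != 0 -> is_derive x 1 f a ->
  is_derive x 1 (fun y : R => (f y)^-1) (- a / f x ^+ 2).
Proof.
move=> f0 hf; apply: (is_derive_eq (is_deriveV f0 hf)).
by rewrite /GRing.scale /=; field.
Qed.

Lemma derive_id_fun x : is_derive x 1 (fun y : R => y) 1.
Proof. exact: is_derive_id. Qed.

Lemma derive_cst_fun x a : is_derive x 1 (fun _ : R => a) 0.
Proof. exact: is_derive_cst. Qed.

Lemma is_derive_continuous f (f' : R -> R) : (forall x, is_derive x 1 f (f' x)) ->
  continuous f.
Proof.
move=> df x; apply/differentiable_continuous/derivable1_diffP.
by have [] := df x.
Qed.

Lemma mean_value f (f' : R -> R) a b : (forall x, is_derive x 1 f (f' x)) -> a <= b ->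
  exists2 c, a <= c <= b & f b - f a = f' c * (b - a).
Proof.
move=> df ab.
have [|c] := @MVT_segment R f f' a b ab (fun x _ => df x).
  exact/continuous_subspaceT/(is_derive_continuous df).
by rewrite in_itv /= => ? ?; exists c.
Qed.

Lemma nondecreasing_from_derive f (f' : R -> R) a : (forall x, is_derive x 1 f (f' x)) ->
  (forall x, a <= x -> 0 <= f' x) -> forall x y, a <= x -> x <= y -> f x <= f y.
Proof.
move=> df f'0 x y ax xy; rewrite -subr_ge0.
have [c /andP[xc _] ->] := mean_value df xy.
by rewrite mulr_ge0 ?subr_ge0 ?f'0 ?(le_trans ax).
Qed.

End derivatives.

(** * Radial composition preserves symmetric slopes *)

Section symmetric_quotient.
Context {R : realType}.
Implicit Types (p k j Psi ka om : R -> R) (a c u s t : R).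

(** Clearing the denominators in the monotonicity of (Psi (a + t) - Psi (a -
    t)) / t over t > 0 makes the condition linear in Psi, so that it passes to
    pointwise limits. *)
Definition sym_slope_nondecreasing Psi a := forall s t, 0 < s -> s <= t ->
  t * (Psi (a + s) - Psi (a - s)) <= s * (Psi (a + t) - Psi (a - t)).

(** L t = Psi (a + t) - Psi (a - t) vanishes at 0 and its second derivative om
    (a + t) - om (a - t) is nonnegative for t >= 0; a convex function
    vanishing at 0 has a nondecreasing slope from 0. *)
Lemma sym_slope_of_convex Psi ka om a :
  (forall u, is_derive u 1 Psi (ka u)) -> (forall u, is_derive u 1 ka (om u)) ->
  {homo om : u v / u <= v} -> sym_slope_nondecreasing Psi a.
Proof.
move=> dPsi dka om_le s t s0 st.
have dadd (h h' : R -> R) (x : R) : (forall u, is_derive u 1 h (h' u)) ->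
    is_derive x 1 (fun y : R => h (a + y)) (h' (a + x)).
  move=> dh; apply: (is_derive_eq (derive_comp_fun
    (deriveD_fun (derive_cst_fun x a) (derive_id_fun x)) (dh (a + x)))).
  by rewrite add0r mulr1.
have dsub (h h' : R -> R) (x : R) : (forall u, is_derive u 1 h (h' u)) ->
    is_derive x 1 (fun y : R => h (a - y)) (- h' (a - x)).
  move=> dh; apply: (is_derive_eq (derive_comp_fun
    (deriveB_fun (derive_cst_fun x a) (derive_id_fun x)) (dh (a - x)))).
  by rewrite sub0r mulrN1.
pose L x := Psi (a + x) - Psi (a - x).
pose M x := ka (a + x) + ka (a - x).
have dL (x : R) : is_derive x 1 L (M x).
  by apply: (is_derive_eq (deriveB_fun (dadd _ _ x dPsi) (dsub _ _ x dPsi))); rewrite opprK.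
have dM (x : R) : is_derive x 1 M (om (a + x) - om (a - x)).
  exact: (deriveD_fun (dadd _ _ x dka) (dsub _ _ x dka)).
have M_le : forall x y, 0 <= x -> x <= y -> M x <= M y.
  apply: (nondecreasing_from_derive dM) => x x0.
  by rewrite subr_ge0 om_le// lerD2l; lra.
have [x x0s Lx] := mean_value dL (ltW s0).
have [y syt Ly] := mean_value dL st.
have /andP[x0 xs] := x0s; have /andP[sy _] := syt.
have M_xy : M x <= M y := M_le _ _ x0 (le_trans xs sy).
have L0 : L 0 = 0 by rewrite /L addr0 subr0 subrr.
rewrite -!/(L _); have -> : L t = L s + M y * (t - s) by lra.
have -> : L s = M x * s by lra.
rewrite -subr_ge0 (_ : _ - _ = s * (t - s) * (M y - M x)); last ring.
by rewrite !mulr_ge0 ?subr_ge0// ltW.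
Qed.


Section radial.
Variables (p k j : R -> R) (c : R).
Hypotheses (p0 : p 0 = 0) (dp : forall x : R, is_derive x 1 p (k x))
  (dk : forall x : R, is_derive x 1 k (j x))
  (j_ge0 : forall x : R, 0 <= x -> 0 <= j x)
  (j_le : forall x y : R, 0 <= x -> x <= y -> j x <= j y).

Let N x := k x * x - p x.

Let dN (x : R) : is_derive x 1 N (j x * x).
Proof.
apply: (is_derive_eq (deriveB_fun (deriveM_fun (dk x) (derive_id_fun x)) (dp x))).
ring.
Qed.

Let N0 : N 0 = 0. Proof. by rewrite /N mulr0 p0 subrr. Qed.

Let N_ge0 (x : R) : 0 <= x -> 0 <= N x.
Proof.
move=> x0; rewrite -N0; apply: (nondecreasing_from_derive dN) (lexx 0) x0.
by move=> y y0; rewrite mulr_ge0// j_ge0.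
Qed.

(** The tangent of the convex function k at x lies below k on [0, x];
    integrating this bounds p x from below. *)
Let N_le (x : R) : 0 <= x -> 2 * N x <= j x * x ^+ 2.
Proof.
move=> x0.
pose e y := p y - k x * y - j x / 2 * (y - x) ^+ 2.
have de (y : R) : is_derive y 1 e (k y - k x - j x * (y - x)).
  have d1 := derive_cst_fun y (k x); have d2 := derive_id_fun y.
  have d3 := deriveB_fun d2 (derive_cst_fun y x).
  apply: (is_derive_eq (deriveB_fun (deriveB_fun (dp y) (deriveM_fun d1 d2))
     (deriveM_fun (derive_cst_fun y (j x / 2)) (deriveM_fun d3 d3)))).
  by field.
have [z /andP[z0 zx] ez] := mean_value de x0.
have [w /andP[zw wx] kzx] := mean_value dk zx.
have jwx : j w <= j x by apply: j_le wx; exact: le_trans zw.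
have : 0 <= e x - e 0.
  rewrite ez mulr_ge0 ?subr0//.
  have -> : k z - k x = - (j w * (x - z)) by rewrite -kzx opprB.
  rewrite (_ : _ - _ = (j x - j w) * (x - z)); last ring.
  by rewrite mulr_ge0 ?subr_ge0.
rewrite /e /N p0; lra.
Qed.

Let D x := N x / x ^+ 2.

(** Past x, N grows at least as fast as j x / 2 times the square, and j x / 2
    >= D x by [N_le]. *)
Let D_le (x y : R) : 0 < x -> x <= y -> D x <= D y.
Proof.
move=> x0 xy; have y0 := lt_le_trans x0 xy.
rewrite /D ler_pdivrMr ?exprn_gt0// mulrAC ler_pdivlMr ?exprn_gt0//.
pose e z := N z - j x / 2 * z ^+ 2.
have de (z : R) : is_derive z 1 e (j z * z - j x * z).
  have d2 := derive_id_fun z.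
  apply: (is_derive_eq (deriveB_fun (dN z)
     (deriveM_fun (derive_cst_fun z (j x / 2)) (deriveM_fun d2 d2)))).
  by field.
have : e x <= e y.
  apply: (nondecreasing_from_derive de) (lexx x) xy => z xz.
  by rewrite -mulrBl mulr_ge0 ?subr_ge0 ?j_le ?(le_trans _ xz)// ltW.
have := N_le (ltW x0).
rewrite /e => h1 h2.
have h3 : 0 <= y ^+ 2 - x ^+ 2.
  by rewrite subr_ge0 ler_pXn2r// nnegrE ltW.
have x2 : 0 <= x ^+ 2 by exact: sqr_ge0.
nra.
Qed.

Let r (u : R) : R := Num.sqrt (u ^+ 2 + c ^+ 2).
Let th u := u / r u.

(** The derivative of u |-> f (sqrt (u ^ 2 + c ^ 2)) when p is the derivative
    of f; th is the derivative of the radius r. *)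
Definition radial u := p (r u) * th u.
(* The first two derivatives of [radial], arranged around j and D, the two
   quantities already known to be monotone. *)
Let ka u := k (r u) * th u ^+ 2 + p (r u) / r u * (1 - th u ^+ 2).
Let om u := j (r u) * th u ^+ 3 + 3 * D (r u) * (th u - th u ^+ 3).

Hypothesis c0 : 0 < c.

Let r_gt0 u : 0 < r u.
Proof. by rewrite sqrtr_gt0 ltr_wpDl ?sqr_ge0// exprn_gt0. Qed.

Let r2 u : r u ^+ 2 = u ^+ 2 + c ^+ 2.
Proof. by rewrite sqr_sqrtr// addr_ge0 ?sqr_ge0. Qed.

Let dr (u : R) : is_derive u 1 r (th u).
Proof.
have u0 : 0 < u ^+ 2 + c ^+ 2 by rewrite -sqrtr_gt0; exact: r_gt0.
have d2 := derive_id_fun u.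
apply: (is_derive_eq (derive_comp_fun
  (deriveD_fun (deriveM_fun d2 d2) (derive_cst_fun u (c ^+ 2))) (is_derive1_sqrt u0))).
rewrite -/(r u) /th; field; exact: lt0r_neq0.
Qed.

Let dth (u : R) : is_derive u 1 th ((1 - th u ^+ 2) / r u).
Proof.
have ru := lt0r_neq0 (r_gt0 u).
apply: (is_derive_eq (deriveM_fun (derive_id_fun u) (deriveV_fun ru (dr u)))).
by rewrite /th; field.
Qed.

Let dradial (u : R) : is_derive u 1 radial (ka u).
Proof.
have ru := lt0r_neq0 (r_gt0 u).
apply: (is_derive_eq (deriveM_fun (derive_comp_fun (dr u) (dp (r u))) (dth u))).
by rewrite /ka; field.
Qed.

Let dka (u : R) : is_derive u 1 ka (om u).
Proof.
have ru := lt0r_neq0 (r_gt0 u).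
have dth2 := deriveM_fun (dth u) (dth u).
have dpr := derive_comp_fun (dr u) (dp (r u)).
have dkr := derive_comp_fun (dr u) (dk (r u)).
apply: (is_derive_eq (deriveD_fun (deriveM_fun dkr dth2)
  (deriveM_fun (deriveM_fun dpr (deriveV_fun ru (dr u)))
    (deriveB_fun (derive_cst_fun u 1) dth2)))).
by rewrite /om /D /N; field.
Qed.

Let rN u : r (- u) = r u. Proof. by rewrite /r sqrrN. Qed.

Let omN u : om (- u) = - om u.
Proof. by rewrite /om /th rN mulNr; ring. Qed.

(** As u increases, so do j (r u), D (r u) and th u in [0, 1]. For fixed
    values of j and D, the polynomial j th ^ 3 + 3 D (th - th ^ 3) is
    nondecreasing in th because 0 <= 2 D <= j. *)
Let om_le0 u v : 0 <= u -> u <= v -> om u <= om v.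
Proof.
move=> u0 uv; have v0 := le_trans u0 uv.
have uv2 : u ^+ 2 <= v ^+ 2 by rewrite ler_pXn2r// nnegrE.
have ruv : r u <= r v by rewrite ler_sqrt ?lerD2r// addr_ge0 ?sqr_ge0.
have thu0 w : 0 <= w -> 0 <= th w by move=> w0; rewrite divr_ge0// ltW.
have th_le1 w : 0 <= w -> th w <= 1.
  move=> w0; rewrite ler_pdivrMr// mul1r -ler_sqr ?nnegrE ?(ltW (r_gt0 w))//.
  by rewrite r2 lerDl sqr_ge0.
have th_le : th u <= th v.
  rewrite /th ler_pdivrMr// mulrAC ler_pdivlMr//.
  rewrite -(@ler_pXn2r _ 2) ?nnegrE ?mulr_ge0 ?(ltW (r_gt0 _))//.
  rewrite !exprMn !r2 !mulrDr [v ^+ 2 * u ^+ 2]mulrC lerD2l.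
  by rewrite ler_pM2r// exprn_gt0.
have jle : j (r u) <= j (r v) by apply: j_le => //; exact: ltW.
have Dle : D (r u) <= D (r v) by exact: D_le.
have D0 : 0 <= D (r u) by rewrite divr_ge0 ?sqr_ge0// N_ge0// ltW.
have jD : 2 * D (r u) <= j (r u).
  by rewrite /D mulrA ler_pdivrMr ?exprn_gt0// N_le// ltW.
rewrite /om; move: (thu0 u u0) (thu0 v v0) (th_le1 u u0) (th_le1 v v0) th_le jle Dle D0 jD.
move: (th u) (th v) (j (r u)) (j (r v)) (D (r u)) (D (r v)).
move=> a b ju jv du dv a0 b0 a1 b1 ab jle Dle D0 jD.
rewrite -subr_ge0 (_ : _ - _ = (jv - ju) * b ^+ 3 + 3 * ((dv - du) * (b * (1 - b) * (1 + b)))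
   + (ju - 2 * du) * ((b - a) * (b ^+ 2 + a * b + a ^+ 2))
   + du * ((b - a) * (3 - (b ^+ 2 + a * b + a ^+ 2)))); last ring.
have hb1 : b ^+ 2 <= 1 by rewrite expr_le1.
have ha1 : a ^+ 2 <= 1 by rewrite expr_le1.
have hab : a * b <= 1 by rewrite mulr_ile1.
by rewrite !addr_ge0// !mulr_ge0// ?subr_ge0// ?exprn_ge0// ?addr_ge0// ?mulr_ge0 ?exprn_ge0//; lra.
Qed.

Let om_homo : {homo om : u v / u <= v}.
Proof.
move=> u v uv.
have om0 : om 0 = 0 by have := omN 0; rewrite oppr0; lra.
have [u0|u0] := lerP 0 u; first exact: om_le0.
have om_lt w : 0 <= w -> 0 <= om w by move=> w0; rewrite -om0; exact: om_le0.
have [v0|v0] := lerP 0 v.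
  have := om_lt _ v0; have := om_lt (- u); rewrite omN oppr_ge0 => /(_ (ltW u0)); lra.
by rewrite -lerN2 -!omN; apply: om_le0; [rewrite oppr_ge0 ltW|rewrite lerN2].
Qed.

(** Composition with the radius keeps the third derivative nondecreasing,
    which is what [sym_slope_of_convex] asks for. *)
Lemma radial_sym_slope a : sym_slope_nondecreasing radial a.
Proof. exact: sym_slope_of_convex dradial dka om_homo. Qed.

End radial.

End symmetric_quotient.

(** * Tangents in the squared variable *)

Section convex_second_derivative.
Context {R : realType}.
Variables (f f1 f2 : R -> R).
Hypotheses (f_even : forall x, f (- x) = f x)
  (df : forall x : R, is_derive x 1 f (f1 x))
  (df1 : forall x : R, is_derive x 1 f1 (f2 x))
  (f2_convex : forall x y t : R, 0 <= t -> t <= 1 ->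
     f2 (t * x + (1 - t) * y) <= t * f2 x + (1 - t) * f2 y).

Lemma derive_even_odd (x : R) : f1 (- x) = - f1 x.
Proof.
have dN := deriveN_fun (derive_id_fun x).
have := derive_comp_fun dN (df (- x)).
have -> : (fun y : R => f (- y)) = f by apply/funext => y; rewrite f_even.
move=> /@derive_val; have /@derive_val -> := df x.
by rewrite mulrN1 => ->; rewrite opprK.
Qed.

Lemma derive2_even (x : R) : f2 (- x) = f2 x.
Proof.
have dN := deriveN_fun (derive_id_fun x).
have := derive_comp_fun dN (df1 (- x)).
have -> : (fun y : R => f1 (- y)) = (fun y => - f1 y).
  by apply/funext => y; rewrite derive_even_odd.
move=> /@derive_val.
have /@derive_val -> := deriveN_fun (df1 x).
by rewrite mulrN1 => /oppr_inj.
Qed.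

(** The inner points a + e and b - e are convex combinations of the outer
    points a - e and b + e, with exchanged weights. *)
Lemma convex_increment (a b e : R) : 0 <= e -> a <= b ->
  f2 (a + e) - f2 (a - e) <= f2 (b + e) - f2 (b - e).
Proof.
rewrite le_eqVlt => /predU1P[<-|e0] ab; first by rewrite !addr0 !subr0 !subrr.
have d0 : 0 < b - a + 2 * e by lra.
pose t := (b - a) / (b - a + 2 * e).
have t0 : 0 <= t by rewrite divr_ge0//; lra.
have t1 : t <= 1 by rewrite ler_pdivrMr//; lra.
have s0 : 0 <= 1 - t by lra.
have s1 : 1 - t <= 1 by lra.
have := f2_convex (a - e) (b + e) t0 t1.
have := f2_convex (a - e) (b + e) s0 s1.
rewrite (_ : 1 - (1 - t) = t); last lra.
have -> : t * (a - e) + (1 - t) * (b + e) = a + e.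
  by rewrite /t; field; exact: lt0r_neq0.
have -> : (1 - t) * (a - e) + t * (b + e) = b - e.
  by rewrite /t; field; exact: lt0r_neq0.
move: (f2 _) (f2 _) (f2 _) (f2 _) => w x y z; lra.
Qed.

(* The quotient q e approximates f1 and is once more differentiable: its first
   two derivatives are k e and j e. *)
Let q (e x : R) := (f (x + e) - f (x - e)) / (2 * e).

Lemma cvg_symmetric_quotient (x : R) : q e x @[e --> 0^'+] --> f1 x.
Proof.
have h0 : h^-1 *: (f (h *: 1 + x) - f x) @[h --> 0^'] --> f1 x.
  by have [dfx <-] := df x; exact: dfx.
have h1 := cvg_dnbhs_at_right h0.
have /cvg_at_leftNP := cvg_dnbhs_at_left h0; rewrite oppr0 => h2.
have := cvgM (cvgD h1 h2) (cvg_cst (2^-1 : R)).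
rewrite (_ : (f1 x + f1 x) * 2^-1 = f1 x); last by field.
move=> h3; apply: (cvg_trans _ (h3 _ _ _)); apply: near_eq_cvg.
near=> e; rewrite /q /= !fctE /GRing.scale /= !mulr1 [- e + x]addrC [e + x]addrC.
by field; exact: lt0r_neq0.
Unshelve. all: end_near. Qed.

Let k (e x : R) := (f1 (x + e) - f1 (x - e)) / (2 * e).
Let j (e x : R) := (f2 (x + e) - f2 (x - e)) / (2 * e).

Let shift_derive (h h' : R -> R) (e x : R) :
  (forall u : R, is_derive u 1 h (h' u)) ->
  is_derive x 1 (fun y : R => (h (y + e) - h (y - e)) / (2 * e))
    ((h' (x + e) - h' (x - e)) / (2 * e)).
Proof.
move=> dh.
have dp := derive_comp_fun (deriveD_fun (derive_id_fun x) (derive_cst_fun x e))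
  (dh (x + e)).
have dm := derive_comp_fun (deriveD_fun (derive_id_fun x) (derive_cst_fun x (- e)))
  (dh (x - e)).
apply: (is_derive_eq (deriveM_fun (deriveB_fun dp dm)
  (derive_cst_fun x (2 * e)^-1))).
ring.
Qed.

Let q_sym_slope (e c a : R) : 0 < e -> 0 <= c ->
  sym_slope_nondecreasing (if c == 0 then q e else radial (q e) c) a.
Proof.
move=> e0 c0.
have dq (x : R) : is_derive x 1 (q e) (k e x) := shift_derive _ _ df.
have dk (x : R) : is_derive x 1 (k e) (j e x) := shift_derive _ _ df1.
have e20 : 0 <= (2 * e)^-1 by rewrite invr_ge0; lra.
have j_le x y : x <= y -> j e x <= j e y.
  by move=> xy; rewrite ler_wpM2r// convex_increment// ltW.
have [_|c_neq0] := eqVneq; first exact: sym_slope_of_convex dq dk j_le.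
apply: (radial_sym_slope _ dq dk).
- by rewrite /q sub0r add0r f_even subrr mul0r.
- move=> x x0; have <- : j e 0 = 0.
    by rewrite /j sub0r add0r derive2_even subrr mul0r.
  exact: j_le.
- by move=> x y _; exact: j_le.
- by rewrite lt_neqAle eq_sym c_neq0.
Qed.

(** The composition argument of [radial_sym_slope] needs two derivatives, and
    f1 has only one. The symmetric quotient q e has two, the second one being
    nondecreasing by convexity of f2, and the inequality obtained for q e
    survives the limit as e tends to 0. *)
Lemma derive_sym_slope (c a : R) : 0 <= c ->
  sym_slope_nondecreasing (if c == 0 then f1 else radial f1 c) a.
Proof.
move=> c0 s t s0 st.
pose Q (g : R -> R) := if c == 0 then g else radial g c.
have cvgQ u : Q (q e) u @[e --> 0^'+] --> Q f1 u.
  rewrite /Q; case: ifP => _; first exact: cvg_symmetric_quotient.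
  by apply: cvgM; [exact: cvg_symmetric_quotient|exact: cvg_cst].
have cvgL g u v : g * (Q (q e) u - Q (q e) v) @[e --> 0^'+] -->
    g * (Q f1 u - Q f1 v).
  by apply: cvgM; [exact: cvg_cst|apply: cvgB].
apply: (ler_cvg_to (cvgL t _ _) (cvgL s _ _)).
near=> e; apply: q_sym_slope => //.
Unshelve. all: end_near. Qed.

(** With K chosen so that G t = phi (a + t) + phi (a - t) - K t ^ 2 is
    stationary at s, the slope condition says that on t >= 0 the even function
    G decreases before s and increases after it. *)
Lemma sym_slope_tangent (phi Psi : R -> R) (a s : R) :
  (forall u : R, is_derive u 1 phi (Psi u)) -> sym_slope_nondecreasing Psi a ->
  0 < s -> exists K, forall t : R,
    phi (a + s) + phi (a - s) + K * (t ^+ 2 - s ^+ 2) <= phi (a + t) + phi (a - t).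
Proof.
move=> dphi slopeP s0.
pose L t := Psi (a + t) - Psi (a - t).
pose K := L s / (2 * s); exists K.
pose G t := phi (a + t) + phi (a - t) - K * t ^+ 2.
have dG (t : R) : is_derive t 1 G (L t - 2 * K * t).
  have d1 := derive_id_fun t.
  have dp := derive_comp_fun (deriveD_fun (derive_cst_fun t a) d1) (dphi (a + t)).
  have dm := derive_comp_fun (deriveB_fun (derive_cst_fun t a) d1) (dphi (a - t)).
  apply: (is_derive_eq (deriveB_fun (deriveD_fun dp dm)
    (deriveM_fun (derive_cst_fun t K) (deriveM_fun d1 d1)))).
  by rewrite /L; ring.
have KE : 2 * K * s = L s by rewrite /K; field; exact: lt0r_neq0.
suff main t : 0 <= t -> G s <= G t.
  move=> t; have := main `|t| (normr_ge0 t); rewrite /G real_normK ?num_real//.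
  by case: (ger0P t) => _; rewrite ?opprK; lra.
move=> t0; have [st|ts] := lerP s t.
  apply: (nondecreasing_from_derive dG _ (lexx s) st) => x sx.
  have /= := slopeP _ _ s0 sx; rewrite -!/(L _) -KE => h.
  rewrite -(@ler_pM2l _ s)// mulr0 mulrBr subr_ge0; lra.
rewrite -subr_le0.
have [x /andP[tx xs] ->] := mean_value dG (ltW ts).
rewrite mulr_le0_ge0 ?subr_ge0 ?(ltW ts)//.
have [x0|x0] := eqVneq x 0; first by rewrite /L x0 addr0 subr0 subrr mulr0 subr0.
have {}x0 : 0 < x by rewrite lt_neqAle eq_sym x0 (le_trans t0).
have /= := slopeP _ _ x0 xs; rewrite -!/(L _) -KE => h.
by rewrite -(@ler_pM2l _ s)// mulr0 mulrBr; lra.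
Qed.

Lemma radial_tangent (c a s : R) : 0 <= c -> 0 < s -> exists K, forall t : R,
  f (Num.sqrt ((a + s) ^+ 2 + c ^+ 2)) + f (Num.sqrt ((a - s) ^+ 2 + c ^+ 2))
    + K * (t ^+ 2 - s ^+ 2)
  <= f (Num.sqrt ((a + t) ^+ 2 + c ^+ 2)) + f (Num.sqrt ((a - t) ^+ 2 + c ^+ 2)).
Proof.
move=> c0 s0; have := derive_sym_slope a c0.
(* For c = 0 the radius is |u|, which is not differentiable, but f is even. *)
have [-> f1_slope|c_neq0 f1_slope] := eqVneq c 0.
  have [K KP] := sym_slope_tangent df f1_slope s0.
  have fE u : f (Num.sqrt (u ^+ 2 + 0 ^+ 2)) = f u.
    rewrite expr0n addr0 sqrtr_sqr.
    by case: (ger0P u) => // _; exact: f_even.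
  by exists K => t; rewrite !fE; exact: KP.
have r0 (u : R) : 0 < u ^+ 2 + c ^+ 2.
  by rewrite ltr_wpDl ?sqr_ge0// exprn_gt0// lt_neqAle eq_sym c_neq0.
suff dphi (u : R) : is_derive u 1 (fun v : R => f (Num.sqrt (v ^+ 2 + c ^+ 2)))
    (radial f1 c u) by exact: sym_slope_tangent dphi f1_slope s0.
have d2 := derive_id_fun u.
have dr := derive_comp_fun
  (deriveD_fun (deriveM_fun d2 d2) (derive_cst_fun u (c ^+ 2))) (is_derive1_sqrt (r0 u)).
apply: (is_derive_eq (derive_comp_fun dr (df _))).
rewrite /radial; have := r0 u; rewrite -sqrtr_gt0 => /lt0r_neq0.
by move: (Num.sqrt _) => r r_neq0; field.
Qed.

(** Completing the square reduces the quadratic polynomial to the shape u ^ 2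
    + c ^ 2 of [radial_tangent]. In the degenerate case C = 0 the discriminant
    condition forces B = 0. *)
Lemma quadratic_tangent (A B C : R) : 0 <= A -> 0 <= C -> B ^+ 2 <= A * C ->
  exists K, forall t : R,
  f (Num.sqrt (A + 2 * B + C)) + f (Num.sqrt (A - 2 * B + C)) + K * (t ^+ 2 - 1)
  <= f (Num.sqrt (A + 2 * B * t + C * t ^+ 2))
     + f (Num.sqrt (A - 2 * B * t + C * t ^+ 2)).
Proof.
move=> A0; rewrite le_eqVlt => /predU1P[<-|C0] BAC.
  exists 0 => t; have -> : B = 0.
    by apply/eqP; rewrite -sqrf_eq0 eq_le sqr_ge0 andbT; move: BAC; rewrite mulr0.
  by rewrite !(mulr0, mul0r, addr0, subr0).
pose s := Num.sqrt C; have s0 : 0 < s by rewrite sqrtr_gt0.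
have sC : s ^+ 2 = C by rewrite sqr_sqrtr// ltW.
pose c2 := A - B ^+ 2 / C.
have c2_ge0 : 0 <= c2 by rewrite subr_ge0 ler_pdivrMr.
have [K KP] := radial_tangent (B / s) (sqrtr_ge0 c2) s0.
exists (K * C) => t; have := KP (s * t); rewrite sqr_sqrtr// exprMn sC.
have s_neq0 := lt0r_neq0 s0.
have E u : (B / s + u * s) ^+ 2 + c2 = A + 2 * B * u + C * u ^+ 2.
  by rewrite /c2 -sC; field.
have -> : (B / s + s) ^+ 2 + c2 = A + 2 * B + C by have := E 1; rewrite mul1r => ->; ring.
have -> : (B / s - s) ^+ 2 + c2 = A - 2 * B + C by have := E (- 1); rewrite mulN1r => ->; ring.
have -> : (B / s + s * t) ^+ 2 + c2 = A + 2 * B * t + C * t ^+ 2.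
  by rewrite [s * t]mulrC E.
have -> : (B / s - s * t) ^+ 2 + c2 = A - 2 * B * t + C * t ^+ 2.
  by rewrite [s * t]mulrC -mulNr E; ring.
by rewrite (_ : K * C * (t ^+ 2 - 1) = K * (C * t ^+ 2 - C)); last ring.
Qed.

Hypothesis f2_ge0 : 0 <= f2 0.

Lemma derive2_ge0 (x : R) : 0 <= f2 x.
Proof.
apply: (le_trans f2_ge0).
have h0 : 0 <= 2^-1 :> R by rewrite invr_ge0.
have h1 : 2^-1 <= 1 :> R by rewrite invf_le1// ler1n.
have := f2_convex x (- x) h0 h1; rewrite derive2_even.
have -> : 2^-1 * x + (1 - 2^-1) * - x = 0 by field.
have -> // : 2^-1 * f2 x + (1 - 2^-1) * f2 x = f2 x by field.
Qed.

(** By convexity and parity f2 is minimal at 0, where it is nonnegative; f1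
    vanishes at 0 by parity, so it is nonnegative on the right of 0. *)
Lemma even_convex_le (x y : R) : 0 <= x -> x <= y -> f x <= f y.
Proof.
apply: (nondecreasing_from_derive df) => {}x x0.
have f10 : f1 0 = 0 by have := derive_even_odd 0; rewrite oppr0; lra.
rewrite -f10; apply: (nondecreasing_from_derive df1) (lexx 0) x0 => z _.
exact: derive2_ge0.
Qed.

End convex_second_derivative.

Section C2_up_conv_theory.
Context {R : realType} (f : R -> R).
Hypothesis hf : C2_up_conv f.

Let f_even (x : R) : f (- x) = f x.
Proof. by have [[]] := hf. Qed.

Let df (x : R) : is_derive x 1 f (derive1 f x).
Proof. by have [[_ h _ _] _ _] := hf; rewrite derive1E; exact: DeriveDef. Qed.

Let df1 (x : R) : is_derive x 1 (derive1 f) (derive1 (derive1 f) x).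
Proof. by have [[_ _ h _] _ _] := hf; rewrite derive1E; exact: DeriveDef. Qed.

Let f2_convex (x y t : R) : 0 <= t -> t <= 1 ->
  derive1 (derive1 f) (t * x + (1 - t) * y)
    <= t * derive1 (derive1 f) x + (1 - t) * derive1 (derive1 f) y.
Proof.
move=> t0 t1; have [[_ _ _ cvx] _ _] := hf.
have h : Itv.spec (@Itv.num_sem R) (Itv.Real `[0%Z, 1%Z]) t.
  by rewrite /= /Itv.num_sem /= in_itv /= t0 t1 ger0_real.
exact: (cvx (Itv.mk h) x y (mem_set I) (mem_set I)).
Qed.

Let f2_ge0 : 0 <= derive1 (derive1 f) 0. Proof. by have [_ _] := hf. Qed.

Lemma C2_up_conv_continuous : continuous f.
Proof. exact: is_derive_continuous df. Qed.

Lemma C2_up_conv_le (x y : R) : 0 <= x -> x <= y -> f x <= f y.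
Proof. exact: (even_convex_le f_even df df1 f2_convex f2_ge0). Qed.

Lemma C2_up_conv_ge0 (x : R) : 0 <= x -> 0 <= f x.
Proof.
by move=> x0; have [_ f0 _] := hf; apply: le_trans f0 _; exact: C2_up_conv_le.
Qed.

Lemma C2_up_conv_quadratic_tangent (A B C : R) :
  0 <= A -> 0 <= C -> B ^+ 2 <= A * C ->
  exists K, forall t : R,
  f (Num.sqrt (A + 2 * B + C)) + f (Num.sqrt (A - 2 * B + C)) + K * (t ^+ 2 - 1)
  <= f (Num.sqrt (A + 2 * B * t + C * t ^+ 2))
     + f (Num.sqrt (A - 2 * B * t + C * t ^+ 2)).
Proof. exact: (quadratic_tangent f_even df df1 f2_convex). Qed.

End C2_up_conv_theory.

(** * Rotations of the normal law *)

Section lebesgue_shear.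
Local Open Scope ereal_scope.
Context {R : realType}.
Local Notation mu := (@lebesgue_measure R).

Lemma lebesgue_measure_translation (a : R) (A : set R) : measurable A ->
  pushforward mu ((fun x => x + a)%R : _ -> measurableTypeR R) A = mu A.
Proof.
move=> mA; have mt : measurable_fun setT ((fun x => x + a)%R : R -> measurableTypeR R).
  exact: measurable_funD.
apply/esym/lebesgue_measure_unique => //= X [[b c] _ <-] /=.
have -> : pushforward mu ((fun x => x + a)%R : _ -> measurableTypeR R) `]b, c]
    = mu `](b - a)%R, (c - a)%R]%classic.
  rewrite /pushforward; congr (mu _); apply/seteqP.
  by split => x /=; rewrite !in_itv /= ltrBlDr lerBrDr.
rewrite !lebesgue_measure_itv /= !lte_fin ltrD2r; case: ifP => // _.
by rewrite -!EFinB; congr EFin; lra.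
Qed.

Lemma ge0_integral_translation (a : R) (f : R -> \bar R) :
  measurable_fun setT f -> (forall x, 0 <= f x) ->
  \int[mu]_x f (x + a)%R = \int[mu]_x f x.
Proof.
move=> mf f0.
have ma : measurable_fun setT ((fun x => x + a)%R : R -> measurableTypeR R).
  exact: measurable_funD.
transitivity (\int[pushforward mu ((fun x => x + a)%R : _ -> measurableTypeR R)]_x f x).
  by rewrite ge0_integral_pushforward.
by apply: eq_measure_integral => A mA _; exact: lebesgue_measure_translation.
Qed.

Definition iterated (G : R * R -> \bar R) := \int[mu]_x \int[mu]_y G (x, y).

Lemma iteratedC (G : R * R -> \bar R) : measurable_fun setT G ->
  (forall z, 0 <= G z) -> iterated G = \int[mu]_y \int[mu]_x G (x, y).
Proof. by move=> mG G0; exact: fubini_tonelli. Qed.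

Let measurable_shear1 (k : R) (G : R * R -> \bar R) : measurable_fun setT G ->
  measurable_fun setT (fun z : R * R => G (z.1 + k * z.2, z.2)%R).
Proof.
move=> mG; apply: measurableT_comp => //; apply: measurable_fun_pair => //.
by apply: measurable_funD => //; exact: measurable_funM.
Qed.

Let measurable_shear2 (k : R) (G : R * R -> \bar R) : measurable_fun setT G ->
  measurable_fun setT (fun z : R * R => G (z.1, z.2 + k * z.1)%R).
Proof.
move=> mG; apply: measurableT_comp => //; apply: measurable_fun_pair => //.
by apply: measurable_funD => //; exact: measurable_funM.
Qed.

Lemma iterated_shear1 (k : R) (G : R * R -> \bar R) : measurable_fun setT G ->
  (forall z, 0 <= G z) ->
  iterated (fun z : R * R => G (z.1 + k * z.2, z.2)%R) = iterated G.
Proof.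
move=> mG G0; rewrite (iteratedC mG G0) (iteratedC (measurable_shear1 k mG) (fun=> G0 _)).
apply: eq_integral => y _ /=.
rewrite (ge0_integral_translation (k * y) (f := fun x => G (x, y)))//.
exact: measurableT_comp.
Qed.

Lemma iterated_shear2 (k : R) (G : R * R -> \bar R) : measurable_fun setT G ->
  (forall z, 0 <= G z) -> iterated (fun z : R * R => G (z.1, z.2 + k * z.1)%R) = iterated G.
Proof.
move=> mG G0; apply: eq_integral => x _ /=.
rewrite (ge0_integral_translation (k * x) (f := fun y => G (x, y)))//.
exact: measurableT_comp.
Qed.

(** A rotation of angle theta is the product of three shears with parameters -
    tan (theta / 2), sin theta and - tan (theta / 2), and a shear acts as a
    translation on each line parallel to one of the axes. *)
Lemma iterated_rotation (c s : R) (G : R * R -> \bar R) : measurable_fun setT G ->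
  (forall z, 0 <= G z) -> s != 0%R -> (c ^+ 2 + s ^+ 2 = 1)%R ->
  iterated (fun z : R * R => G (c * z.1 - s * z.2, s * z.1 + c * z.2)%R) = iterated G.
Proof.
(* k = - tan (theta / 2) *)
move=> mG G0 s0 cs; pose k := (- ((1 - c) / s))%R.
have mG1 := measurable_shear1 k mG; have mG2 := measurable_shear2 s mG1.
rewrite -(iterated_shear1 k mG G0) -(iterated_shear2 s mG1 (fun=> G0 _)).
rewrite -(iterated_shear1 k mG2 (fun=> G0 _)).
have k1 : (1 + s * k = c)%R by rewrite /k; field.
have k2 : (k * (1 + c) = - s)%R.
  rewrite /k mulNr; congr (- _)%R; rewrite mulrAC.
  by rewrite (_ : (1 - c) * (1 + c) = s * s)%R ?mulfK//; lra.
congr iterated; apply/funext => -[x y] /=; congr (G (_, _)).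
  rewrite -k1 mulrDl -mulNr -k2 -k1; ring.
by rewrite -k1; ring.
Qed.

End lebesgue_shear.

Section standard_normal.
Local Open Scope ereal_scope.
Context {R : realType}.
Local Notation mu := (@lebesgue_measure R).
Local Notation gauss := (@normal_prob R 0 1).
Local Notation pdf := (@normal_pdf R 0 1).

Import HBNNSimple.

Let integral_nnsfun (f : {nnsfun (measurableTypeR R) >-> R}) :
  \int[gauss]_x (f x)%:E = \int[mu]_x ((f x)%:E * (pdf x)%:E).
Proof.
have pdf0 x : 0 <= (pdf x)%:E by rewrite lee_fin normal_pdf_ge0.
have mpdf : measurable_fun setT (fun x => (pdf x)%:E).
  by apply/measurable_EFinP; exact: measurable_normal_pdf.
have mf1 r : measurable_fun [set: measurableTypeR R]
    (fun x : measurableTypeR R => (r * \1_(f @^-1` [set r]) x)%:E).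
  by apply/measurable_EFinP/measurable_funM.
under [LHS]eq_integral do rewrite fimfunE -fsumEFin//.
rewrite [LHS]ge0_integral_fsum//; last first.
  by move=> n x _; rewrite EFinM nnfun_muleindic_ge0.
under [RHS]eq_integral.
  move=> x xD; rewrite fimfunE -fsumEFin// muleC ge0_mule_fsumr; last first.
    by move=> r; rewrite EFinM nnfun_muleindic_ge0.
  over.
rewrite [RHS]ge0_integral_fsum//; last 2 first.
  - by move=> r; apply: emeasurable_funM => //; exact: mf1.
  - by move=> n x _; rewrite EFinM mule_ge0// nnfun_muleindic_ge0.
apply: eq_fsbigr => r _.
rewrite integralZl_indic_nnsfun//= integral_indic//= setIT.
have mr : measurable (f @^-1` [set r]) by exact/measurable_sfunP.
have [r0|r0] := ltP r 0%R.
  rewrite preimage_nnfun0// measure0 mule0 integral0_eq// => x _.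
  by rewrite indic0 mulr0 mule0.
under eq_integral do rewrite EFinM muleCA.
rewrite ge0_integralZl_EFin//; last 2 first.
  - by move=> x _; rewrite mule_ge0.
  - apply: emeasurable_funM => //; exact/measurable_EFinP/measurable_indic.
congr (_ * _); set A := _ @^-1` _.
transitivity (\int[mu]_(x in A) (pdf x)%:E); first by [].
rewrite [LHS]integral_mkcond; apply: eq_integral => x _.
by rewrite patchE indicE; case: ifPn => _; rewrite ?mule1 ?mule0.
Qed.

(** The formula holds for indicators by definition of the normal law, hence
    for simple functions, and passes to increasing limits. *)
Lemma ge0_integral_normal (f : measurableTypeR R -> \bar R) :
  measurable_fun setT f ->
  (forall x, 0 <= f x) ->
  \int[gauss]_x f x = \int[mu]_x (f x * (pdf x)%:E).
Proof.
move=> mf f0.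
have pdf0 x : 0 <= (pdf x)%:E by rewrite lee_fin normal_pdf_ge0.
have mpdf : measurable_fun setT (fun x => (pdf x)%:E).
  by apply/measurable_EFinP; exact: measurable_normal_pdf.
pose f_ := nnsfun_approx measurableT mf.
have f_cvg x : (EFin \o f_ ^~ x) @ \oo --> f x by exact: cvg_nnsfun_approx.
transitivity (lim (\int[gauss]_x (f_ n x)%:E @[n --> \oo])).
  rewrite -monotone_convergence//=.
  - by apply: eq_integral => x _; apply/esym/cvg_lim => //; exact: f_cvg.
  - by move=> n; apply/measurable_EFinP; exact: measurable_funPT.
  - by move=> n ? _; rewrite lee_fin.
  - by move=> ? _ ? ? mn; rewrite lee_fin; exact/lefP/nd_nnsfun_approx.
under eq_fun do rewrite integral_nnsfun.
rewrite -monotone_convergence//=.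
- apply: eq_integral => x _; apply/cvg_lim => //.
  apply: cvgeZr => //; exact: f_cvg.
- by move=> n; apply: emeasurable_funM => //; apply/measurable_EFinP; exact: measurable_funPT.
- by move=> n ? _; rewrite mule_ge0// lee_fin.
- move=> x _ m n mn; rewrite lee_wpmul2r// lee_fin; exact/lefP/nd_nnsfun_approx.
Qed.

End standard_normal.

Section standard_normal_rotation.
Local Open Scope ereal_scope.
Context {R : realType}.
Local Notation mu := (@lebesgue_measure R).
Local Notation gauss := (@normal_prob R 0 1).
Local Notation pdf := (@normal_pdf R 0 1).

Let pdf0 x : 0 <= (pdf x)%:E.
Proof. by rewrite lee_fin normal_pdf_ge0. Qed.

Let mpdf : measurable_fun setT (fun x => (pdf x)%:E).
Proof. by apply/measurable_EFinP; exact: measurable_normal_pdf. Qed.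

Let pdfE (x : R) : pdf x = (normal_peak 1 * expR (- x ^+ 2 / 2))%R.
Proof.
by rewrite normal_pdfE ?oner_neq0// /normal_fun subr0 expr1n.
Qed.

Lemma measurable_normal_integral {d} {U : measurableType d}
    (F : U * R -> \bar R) : measurable_fun setT F -> (forall z, 0 <= F z) ->
  measurable_fun setT (fun u => \int[gauss]_y F (u, y)).
Proof.
by move=> mF F0; exact: (measurable_fun_fubini_tonelli_F (m2 := gauss) F mF F0).
Qed.

Let iterated_normal (F : R * R -> \bar R) : measurable_fun setT F ->
  (forall z, 0 <= F z) ->
  \int[gauss]_x \int[gauss]_y F (x, y) =
  iterated (fun z => F z * (pdf z.1 * pdf z.2)%:E).
Proof.
move=> mF F0.
rewrite ge0_integral_normal//; last 2 first.
  exact: measurable_normal_integral.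
  by move=> x; apply: integral_ge0.
apply: eq_integral => x _ /=.
rewrite ge0_integral_normal//; last exact: measurableT_comp.
rewrite -ge0_integralZr//; last 2 first.
- by apply: emeasurable_funM => //; exact: measurableT_comp.
- by move=> y _; rewrite mule_ge0.
by apply: eq_integral => y _; rewrite EFinM -muleA [(pdf x)%:E * _]muleC.
Qed.

(** The density of a pair of independent standard normal variables depends
    only on x ^ 2 + y ^ 2, so the invariance is inherited from that of the
    Lebesgue measure. *)
Lemma normal_rotation (c s : R) (F : R * R -> \bar R) : measurable_fun setT F ->
  (forall z, 0 <= F z) -> s != 0%R -> (c ^+ 2 + s ^+ 2 = 1)%R ->
  \int[gauss]_x \int[gauss]_y F (c * x - s * y, s * x + c * y)%R =
  \int[gauss]_x \int[gauss]_y F (x, y).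
Proof.
move=> mF F0 s0 cs.
pose G z := F z * (pdf z.1 * pdf z.2)%:E.
have mG : measurable_fun setT G.
  apply: emeasurable_funM => //; under eq_fun do rewrite EFinM.
  by apply: emeasurable_funM; apply: (measurableT_comp mpdf).
have G0 z : 0 <= G z by rewrite mule_ge0// EFinM mule_ge0.
have mrot : measurable_fun setT
    (fun z : R * R => F (c * z.1 - s * z.2, s * z.1 + c * z.2)%R).
  apply: measurableT_comp => //; apply: measurable_fun_pair.
    by apply: measurable_funB; exact: measurable_funM.
  by apply: measurable_funD; exact: measurable_funM.
rewrite (iterated_normal mF F0) -/G -(iterated_rotation mG G0 s0 cs).
rewrite (iterated_normal mrot (fun=> F0 _)); congr iterated.
apply/funext => -[x y] /=; rewrite /G /=; congr (_ * _%:E).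
rewrite !pdfE [LHS]mulrACA [RHS]mulrACA -!expRD; congr (_ * expR _)%R.
rewrite -!mulrDl; congr (_ / 2)%R.
transitivity (- ((c ^+ 2 + s ^+ 2) * (x ^+ 2 + y ^+ 2)))%R; last by ring.
by rewrite cs; ring.
Qed.

Lemma normal_setT : gauss setT = 1.
Proof. exact: probability_setT. Qed.

Let m := \int[gauss]_x (x ^+ 2)%:E.

Let msqr : measurable_fun setT (fun x : R => (x ^+ 2)%:E).
Proof. by apply/measurable_EFinP. Qed.

Let m0 : 0 <= m.
Proof. by apply: integral_ge0 => x _; rewrite lee_fin sqr_ge0. Qed.

Let mexp (a : R) : measurable_fun setT (fun x : R => (expR (a * x ^+ 2))%:E).
Proof.
by apply/measurable_EFinP; apply: measurableT_comp => //; exact: measurable_funM.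
Qed.

(** The integrand turns the standard normal density into s times the density
    of the normal law with standard deviation s. *)
Let integral_expR_sqr (s : R) : (0 < s)%R ->
  \int[gauss]_x (expR ((1 - (s ^+ 2)^-1) / 2 * x ^+ 2))%:E = s%:E.
Proof.
move=> s0; have s_neq0 := lt0r_neq0 s0.
rewrite (ge0_integral_normal (mexp _)); last by move=> x; rewrite lee_fin expR_ge0.
transitivity (\int[mu]_x (s%:E * (normal_pdf 0 s x)%:E)).
  apply: eq_integral => x _; rewrite -!EFinM pdfE normal_pdfE// /normal_fun subr0.
  have -> : normal_peak s = (s^-1 * normal_peak 1)%R.
    rewrite /normal_peak expr1n mul1r -mulrnAr sqrtrM ?sqr_ge0// sqrtr_sqr.
    by rewrite gtr0_norm// invfM.
  rewrite mulrCA -expRD !mulrA divff// mul1r.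
  by congr (_ * expR _)%:E; rewrite -mulr_natr; field.
rewrite ge0_integralZl_EFin//; last 3 first.
- by move=> x _; rewrite lee_fin normal_pdf_ge0.
- by apply/measurable_EFinP; exact: measurable_normal_pdf.
- exact: ltW.
by rewrite integral_normal_pdf mule1.
Qed.

(** Integrating 1 + a x ^ 2 <= exp (a x ^ 2) by [integral_expR_sqr], where a
    has the sign of s - 1, bounds the second moment by s ^ 2 from above for s
    > 1 and from below for s < 1. *)
Lemma normal_second_moment : \int[gauss]_x (x ^+ 2)%:E = 1.
Proof.
rewrite -/m.
have int1 : \int[gauss]_x (1%R)%:E = 1 by rewrite integral_cst// mul1e; exact: normal_setT.
have scale (a : R) : (0 <= a)%R -> \int[gauss]_x (a%:E * (x ^+ 2)%:E) = a%:E * m.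
  move=> a0; rewrite ge0_integralZl_EFin// => x _; by rewrite lee_fin sqr_ge0.
have ax (a : R) : (0 <= a)%R ->
    (forall x, setT x -> 0 <= a%:E * (x ^+ 2)%:E) /\
    measurable_fun setT (fun x : R => a%:E * (x ^+ 2)%:E).
  move=> a0; split; last exact: measurable_funeM.
  by move=> x _; rewrite -EFinM lee_fin mulr_ge0 ?sqr_ge0.
have up (v : R) : (1 < v)%R -> m <= v%:E.
  move=> v1; pose s := Num.sqrt v.
  have s1 : (1 < s)%R by rewrite -[1%R]sqrtr1 ltr_sqrt// (lt_trans _ v1).
  have sv : (s ^+ 2 = v)%R by rewrite sqr_sqrtr// ltW// (lt_trans _ v1).
  have s0 : (0 < s)%R by rewrite (lt_trans _ s1).
  pose a := ((1 - (s ^+ 2)^-1) / 2)%R.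
  have a0 : (0 < a)%R by rewrite divr_gt0// subr_gt0 invf_lt1 sv// (lt_trans _ v1).
  have : 1 + a%:E * m <= s%:E.
    have [z0 mz] := ax a (ltW a0).
    have -> : 1 + a%:E * m = \int[gauss]_x (1 + a%:E * (x ^+ 2)%:E).
      by rewrite ge0_integralD// int1 scale// ltW.
    rewrite -(integral_expR_sqr s0); apply: ge0_le_integral => //.
    - by move=> x _; apply: adde_ge0 => //; exact: z0.
    - exact: emeasurable_funD.
    - exact: mexp.
    - by move=> x _; rewrite -EFinM -EFinD lee_fin expR_ge1Dx.
  case: m m0 => [r| |//]; last by rewrite gt0_muley ?lte_fin.
  rewrite -EFinM -EFinD !lee_fin => r0 ar.
  have ar' : (a * r <= s - 1)%R by lra.
  have aE : (a * (2 * s ^+ 2) = (s - 1) * (s + 1))%R by rewrite /a; field; exact: lt0r_neq0.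
  have : (a * r <= a * s ^+ 2)%R by nra.
  by rewrite ler_pM2l// sv.
have low (v : R) : (0 < v)%R -> (v < 1)%R -> v%:E <= m.
  move=> v0 v1; pose s := Num.sqrt v.
  have s1 : (s < 1)%R by rewrite -[1%R]sqrtr1 ltr_sqrt.
  have sv : (s ^+ 2 = v)%R by rewrite sqr_sqrtr// ltW.
  have s0 : (0 < s)%R by rewrite sqrtr_gt0.
  pose a := (((s ^+ 2)^-1 - 1) / 2)%R.
  have a0 : (0 < a)%R by rewrite divr_gt0// subr_gt0 invf_gt1 sv.
  have : 1 <= s%:E + a%:E * m.
    have [z0 mz] := ax a (ltW a0).
    have e0 x : setT x -> 0 <= (expR ((1 - (s ^+ 2)^-1) / 2 * x ^+ 2))%:E.
      by move=> _; rewrite lee_fin expR_ge0.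
    have me := mexp ((1 - (s ^+ 2)^-1) / 2).
    have -> : s%:E + a%:E * m = \int[gauss]_x
        ((expR ((1 - (s ^+ 2)^-1) / 2 * x ^+ 2))%:E + a%:E * (x ^+ 2)%:E).
      by rewrite ge0_integralD// integral_expR_sqr// scale// ltW.
    rewrite -{1}int1; apply: ge0_le_integral => //.
    - exact: emeasurable_funD.
    - move=> x _; rewrite -EFinM -EFinD lee_fin -lerBlDr (le_trans _ (expR_ge1Dx _))//.
      by rewrite /a lerD2l -mulNr -mulNr opprB.
  case: m m0 => [r|_ _|//]; last by rewrite leey.
  rewrite -EFinM -EFinD !lee_fin => r0 ar.
  have aE : (a * (2 * s ^+ 2) = (1 - s) * (1 + s))%R by rewrite /a; field; exact: lt0r_neq0.
  have ar' : (1 - s <= a * r)%R by lra.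
  have : (a * s ^+ 2 <= a * r)%R by nra.
  by rewrite ler_pM2l// sv.
have mfin : m \is a fin_num.
  by rewrite ge0_fin_numE// (le_lt_trans (up 2%R _)) ?ltry// ltr1n.
move: mfin up low; case: m => // r _ up low; congr EFin; apply/eqP.
rewrite eq_le; apply/andP; split; apply/ler_addgt0Pr => e e0.
  by have := up (1 + e)%R; rewrite lee_fin; apply; rewrite ltrDl.
have [e1|e1] := ltP e 1%R; last first.
  have h0 : (0 < 2^-1 :> R)%R by rewrite invr_gt0.
  have h1 : (2^-1 < 1 :> R)%R by rewrite invf_lt1// ltr1n.
  by have := low _ h0 h1; rewrite lee_fin; lra.
have h0 : (0 < 1 - e)%R by lra.
have h1 : (1 - e < 1)%R by lra.
by have := low _ h0 h1; rewrite lee_fin; lra.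
Qed.

End standard_normal_rotation.

(** * Gaussian sums of vectors *)

Section matrix_measurability.
Context {R : realType} {d : measure_display} {T : measurableType d}.

Lemma measurable_matrix_entry m n (i : 'I_m) (j : 'I_n) :
  measurable_fun setT (fun M : 'M[R]_(m, n) => M i j).
Proof.
move=> _ B mB; rewrite setTI; apply: sub_sigma_algebra.
by exists (i, j) => //; exists B => //; rewrite setTI.
Qed.

Lemma measurable_fun_matrix m n (h : T -> 'M[R]_(m, n)) :
  (forall i j, measurable_fun setT (fun t => h t i j)) -> measurable_fun setT h.
Proof.
move=> mh; apply: (@measurability _ _ T 'M[R]_(m, n) setT h
  (\bigcup_(ij in [set: 'I_m * 'I_n]) preimage_set_system setT
     (fun M : 'M[R]_(m, n) => M ij.1 ij.2) measurable)) => //.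
move=> _ [_ [[i j] _ [B mB <-]] <-].
rewrite !setTI; have := mh i j measurableT B mB.
by rewrite setTI.
Qed.

End matrix_measurability.

Section gaussian_smoothing.
Local Open Scope ereal_scope.
Context {R : realType} {d : nat}.
Local Notation gauss := (@normal_prob R 0 1).
Implicit Types (h : 'rV[R]_d -> \bar R) (v x : 'rV[R]_d) (vs : seq 'rV[R]_d).

(** The expectation of h (x + g_1 v_1 + ... + g_k v_k) for independent
    standard normal g_i, as an iterated integral. *)
Fixpoint gauss_smooth h vs : 'rV[R]_d -> \bar R :=
  if vs is v :: vs' then fun x => \int[gauss]_g gauss_smooth h vs' (x + g *: v)%R
  else h.

Lemma measurable_row_line {d'} {T : measurableType d'} (u : T -> 'rV[R]_d)
    (g : T -> R) v : measurable_fun setT u -> measurable_fun setT g ->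
  measurable_fun setT (fun t => u t + g t *: v)%R.
Proof.
move=> mu mg; apply: measurable_fun_matrix => i j.
under eq_fun do rewrite !mxE.
apply: measurable_funD; last exact: measurable_funM.
exact: (measurableT_comp (measurable_matrix_entry i j)).
Qed.

Lemma gauss_smooth_ge0 h vs : (forall x, 0 <= h x) ->
  forall x, 0 <= gauss_smooth h vs x.
Proof.
move=> h0; elim: vs => [//|v vs IH] x /=.
by apply: integral_ge0 => g _; exact: IH.
Qed.

Lemma measurable_gauss_smooth h vs : measurable_fun setT h ->
  (forall x, 0 <= h x) -> measurable_fun setT (gauss_smooth h vs).
Proof.
move=> mh h0; elim: vs => [//|v vs IH] /=.
pose F (z : 'rV[R]_d * R) := gauss_smooth h vs (z.1 + z.2 *: v)%R.
apply: (measurable_normal_integral (F := F)).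
  by apply: (measurableT_comp IH); exact: measurable_row_line.
by move=> z; exact: gauss_smooth_ge0.
Qed.

Lemma gauss_smooth_cat h vs ws :
  gauss_smooth h (vs ++ ws) = gauss_smooth (gauss_smooth h ws) vs.
Proof. by elim: vs => [//|v vs IH] /=; rewrite IH. Qed.

Lemma gauss_smooth0 h x (vs : seq 'rV[R]_d) : (forall v, v \in vs -> v = 0%R) ->
  gauss_smooth h vs x = h x.
Proof.
elim: vs => [//|v vs IH] vs0 /=.
rewrite (vs0 v) ?mem_head//.
under eq_integral do rewrite scaler0 addr0.
rewrite integral_cst// [X in _ * X]normal_setT mule1.
by apply: IH => w wvs; apply: vs0; rewrite inE wvs orbT.
Qed.

Lemma gauss_smooth_rotation h v w vs x (c s : R) : measurable_fun setT h ->
  (forall x, 0 <= h x) -> s != 0%R -> (c ^+ 2 + s ^+ 2 = 1)%R ->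
  gauss_smooth h (v :: w :: vs) x =
  gauss_smooth h (c *: v + s *: w :: c *: w - s *: v :: vs)%R x.
Proof.
move=> mh h0 s0 cs /=.
pose F (z : R * R) := gauss_smooth h vs (x + z.1 *: v + z.2 *: w)%R.
have mF : measurable_fun setT F.
  apply: (measurableT_comp (measurable_gauss_smooth vs mh h0)).
  by apply: measurable_row_line => //; exact: measurable_row_line.
have F0 z : 0 <= F z by exact: gauss_smooth_ge0.
rewrite -(normal_rotation mF F0 s0 cs).
apply: eq_integral => a _; apply: eq_integral => b _.
rewrite /F /=; congr (gauss_smooth h vs _).
rewrite -!addrA; congr (_ + _)%R; apply/matrixP => i j; rewrite !mxE; ring.
Qed.

Definition gram vs : 'M[R]_d := (\sum_(v <- vs) v^T *m v)%R.

Definition vanishes_below (k : nat) v := forall i : 'I_d, (i < k)%N -> v ord0 i = 0%R.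

(** Equality of the laws of the Gaussian sums, tested on nonnegative
    functions. The Gram matrix is carried along because the quadratic form
    evaluated on such a sum is built from it. *)
Definition gauss_equivalent vs ws := gram vs = gram ws /\
  forall h, measurable_fun setT h -> (forall x, 0 <= h x) ->
    gauss_smooth h vs =1 gauss_smooth h ws.

Lemma gram_cat vs ws : gram (vs ++ ws) = (gram vs + gram ws)%R.
Proof. by rewrite /gram big_cat. Qed.

Lemma gauss_equivalent_trans us vs ws : gauss_equivalent us vs ->
  gauss_equivalent vs ws -> gauss_equivalent us ws.
Proof.
move=> [g1 h1] [g2 h2]; split; first by rewrite g1.
by move=> h mh h0 x; rewrite h1// h2.
Qed.

Lemma gauss_equivalent_cons v vs ws : gauss_equivalent vs ws ->
  gauss_equivalent (v :: vs) (v :: ws).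
Proof.
move=> [g1 h1]; split; first by rewrite /gram !big_cons -/(gram _) g1.
by move=> h mh h0 x /=; apply: eq_integral => g _; rewrite h1.
Qed.

Lemma gauss_equivalent_rcons v vs ws : gauss_equivalent vs ws ->
  gauss_equivalent (rcons vs v) (rcons ws v).
Proof.
move=> [g1 h1]; rewrite -!cats1; split; first by rewrite !gram_cat g1.
move=> h mh h0 x; rewrite !gauss_smooth_cat h1//.
  exact: measurable_gauss_smooth.
exact: gauss_smooth_ge0.
Qed.

Lemma gauss_equivalent_rotation v w vs (c s : R) : s != 0%R ->
  (c ^+ 2 + s ^+ 2 = 1)%R ->
  gauss_equivalent (v :: w :: vs) (c *: v + s *: w :: c *: w - s *: v :: vs)%R.
Proof.
move=> s0 cs; split; last by move=> h mh h0 x; exact: gauss_smooth_rotation.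
rewrite /gram !big_cons !addrA; congr (_ + _)%R; apply/matrixP => i j.
rewrite !mxE !big_ord1 !mxE.
move: (v ord0 i) (v ord0 j) (w ord0 i) (w ord0 j) => a b a' b'.
transitivity ((c ^+ 2 + s ^+ 2) * (a * b + a' * b'))%R; last by ring.
by rewrite cs mul1r.
Qed.

(** Givens rotations: a pivot travels through the list and is rotated with
    each vector in turn, so that the vector left behind has coordinate k equal
    to 0; the pivot ends up last. *)
Lemma gauss_eliminate (k : 'I_d) p vs : vanishes_below k p ->
  (forall v, v \in vs -> vanishes_below k v) ->
  exists p' ws, [/\ gauss_equivalent (p :: vs) (rcons ws p'),
    vanishes_below k p' & forall v, v \in ws -> vanishes_below k.+1 v].
Proof.
have below v : vanishes_below k v -> v ord0 k = 0%R -> vanishes_below k.+1 v.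
  move=> vk v0 i; rewrite ltnS leq_eqVlt => /orP[/eqP/val_inj ->//|]; exact: vk.
elim: vs p => [|v vs IH] p pk vsk.
  by exists p, [::].
have vk : vanishes_below k v by apply: vsk; rewrite mem_head.
have {}vsk w : w \in vs -> vanishes_below k w.
  by move=> wvs; apply: vsk; rewrite inE wvs orbT.
have [p0|p0] := eqVneq (p ord0 k) 0%R.
  have [p' [ws [E p'k wsk]]] := IH v vk vsk.
  exists p', (p :: ws); split => //; first exact: gauss_equivalent_cons.
  by move=> w; rewrite inE => /orP[/eqP ->|/wsk//]; exact: below.
pose rho := Num.sqrt (p ord0 k ^+ 2 + v ord0 k ^+ 2).
have rho2 : (rho ^+ 2 = p ord0 k ^+ 2 + v ord0 k ^+ 2)%R.
  by rewrite sqr_sqrtr// addr_ge0 ?sqr_ge0.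
have rho0 : rho != 0%R.
  rewrite -sqrf_eq0 rho2 gt_eqF// ltr_pwDl ?sqr_ge0//.
  by rewrite lt_neqAle sqr_ge0 andbT eq_sym sqrf_eq0.
(* This rotation sends the coordinates k of p and v to 0 and - rho. *)
pose c := (- v ord0 k / rho)%R; pose s := (p ord0 k / rho)%R.
have s0 : s != 0%R by rewrite mulf_neq0// invr_eq0.
have cs : (c ^+ 2 + s ^+ 2 = 1)%R.
  rewrite /c /s !expr_div_n sqrrN -mulrDl addrC -rho2 divff// sqrf_eq0//.
have vanish_lin (a b : R) : vanishes_below k (a *: p + b *: v)%R.
  by move=> i ik; rewrite !mxE pk// vk// !mulr0 addr0.
have p1k : vanishes_below k (c *: v - s *: p)%R.
  by rewrite addrC -scaleNr; exact: vanish_lin.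
have [p' [ws [E p'k wsk]]] := IH _ p1k vsk.
exists p', (c *: p + s *: v :: ws)%R; split => //.
  apply: gauss_equivalent_trans (gauss_equivalent_rotation _ _ _ s0 cs) _.
  exact: gauss_equivalent_cons.
move=> w; rewrite inE => /orP[/eqP ->|/wsk//]; apply: below => //.
by rewrite !mxE /c /s; field.
Qed.

(** Elimination by rotations, one coordinate at a time: each coordinate uses
    up one vector, and vectors with no coordinate left are 0 and can be
    dropped. *)
Lemma gauss_reduce vs : exists2 ws, (size ws <= d)%N & gauss_equivalent vs ws.
Proof.
(* m is the number of coordinates still to be eliminated. *)
suff main m us : (m <= d)%N -> (forall v, v \in us -> vanishes_below (d - m) v) ->
    exists2 ws, (size ws <= m)%N & gauss_equivalent us ws.
  by apply: main => // v _ i; rewrite subnn.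
elim: m us => [|m IH] us md usk.
  have us0 v : v \in us -> v = 0%R.
    move=> vus; apply/rowP => i; rewrite mxE.
    have := usk v vus i; rewrite subn0; exact.
  exists [::] => //; split.
    by rewrite /gram big_nil big1_seq// => v /andP[_ /us0 ->]; rewrite mulmx0.
  by move=> h mh h0 x; rewrite gauss_smooth0.
case: us usk => [|p us] usk; first by exists [::].
have dm : (d - m.+1 < d)%N by rewrite ltn_subrL (leq_trans _ md).
have [||p' [ws [E p'k wsk]]] := @gauss_eliminate (Ordinal dm) p us.
- by apply: usk; rewrite mem_head.
- by move=> v vus; apply: usk; rewrite inE vus orbT.
have [|zs zsm E'] := IH ws (ltnW md).
  by move=> v /wsk /=; rewrite subnSK.
exists (rcons zs p'); first by rewrite size_rcons.
exact: gauss_equivalent_trans E (gauss_equivalent_rcons _ E').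
Qed.

End gaussian_smoothing.

(** * Replacing signs by normal variables *)

Section normal_jensen.
Local Open Scope ereal_scope.
Context {R : realType}.
Local Notation gauss := (@normal_prob R 0 1).

Lemma integral_normal_cst (a : \bar R) : \int[gauss]_y a = a.
Proof. by rewrite integral_cst// [X in _ * X]normal_setT mule1. Qed.

(** A quarter turn of the plane sends the first coordinate to the opposite of
    the second. *)
Lemma integral_normal_opp (f : R -> \bar R) : measurable_fun setT f ->
  (forall x, 0 <= f x) -> \int[gauss]_x f (- x)%R = \int[gauss]_x f x.
Proof.
move=> mf f0; pose F (z : R * R) := f z.1.
have mF : measurable_fun setT F by exact: measurableT_comp.
have := normal_rotation (c := 0) mF (fun=> f0 _) (oner_neq0 _).
rewrite expr0n expr1n add0r => /(_ erefl); rewrite /F /=.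
under eq_integral do under eq_integral do rewrite mul0r mul1r sub0r.
rewrite integral_normal_cst => ->; apply: eq_integral => x _.
exact: integral_normal_cst.
Qed.

(** Jensen's inequality for functions of t ^ 2, in tangent form: the
    correction K (t ^ 2 - 1) has mean 0. *)
Lemma normal_sqr_jensen (phi : R -> R) (c K : R) : measurable_fun setT phi ->
  (forall t, 0 <= phi t)%R -> (0 <= c)%R ->
  (forall t : R, c + K * (t ^+ 2 - 1) <= phi t + phi (- t))%R ->
  (c / 2)%:E <= \int[gauss]_t (phi t)%:E.
Proof.
move=> mphi phi0 c0 ineq.
have mE (a : R -> R) : measurable_fun setT a -> measurable_fun setT (fun t => (a t)%:E).
  by move=> ma; apply/measurable_EFinP.
have msq (a : R) : measurable_fun setT (fun t : R => a * t ^+ 2)%R.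
  exact: measurable_funM.
have int_sq (a b : R) : (0 <= a)%R -> (0 <= b)%R ->
    \int[gauss]_t (a * t ^+ 2 + b)%:E = (a + b)%:E.
  move=> a0 b0; under eq_integral do rewrite EFinD.
  rewrite ge0_integralD//; last 2 first.
  - by move=> t _; rewrite lee_fin mulr_ge0// sqr_ge0.
  - exact: mE.
  under eq_integral do rewrite EFinM.
  rewrite ge0_integralZl_EFin//; last 2 first.
  - by move=> t _; rewrite lee_fin sqr_ge0.
  - exact: mE.
  by rewrite normal_second_moment integral_normal_cst mule1.
have mphiN : measurable_fun setT (fun t : R => phi (- t))%R by exact: measurableT_comp.
(* Splitting K into its positive and negative parts keeps all the integrands
   nonnegative, as the integral of phi may be infinite. *)
pose Kp := Num.max K 0%R; pose Km := Num.max (- K)%R 0%R.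
have Kp0 : (0 <= Kp)%R by rewrite le_max lexx orbT.
have Km0 : (0 <= Km)%R by rewrite le_max lexx orbT.
have KE : (K = Kp - Km)%R.
  by rewrite /Kp /Km /Num.max; case: ltP => ?; case: ltP => ?; lra.
have : \int[gauss]_t (Kp * t ^+ 2 + (c + Km))%:E <=
    \int[gauss]_t ((phi t)%:E + (phi (- t))%:E + (Km * t ^+ 2 + Kp)%:E).
  apply: ge0_le_integral => //.
  - by move=> t _; rewrite lee_fin addr_ge0 ?addr_ge0// mulr_ge0 ?sqr_ge0.
  - by apply: mE; apply: measurable_funD.
  - apply: emeasurable_funD; first by apply: emeasurable_funD; exact: mE.
    by apply: mE; apply: measurable_funD.
  - by move=> t _; rewrite -!EFinD lee_fin; have := ineq t; rewrite KE; lra.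
rewrite ge0_integralD//; last 4 first.
- by move=> t _; rewrite -EFinD lee_fin addr_ge0.
- by apply: emeasurable_funD; exact: mE.
- by move=> t _; rewrite lee_fin addr_ge0// mulr_ge0 ?sqr_ge0.
- by apply: mE; apply: measurable_funD.
rewrite ge0_integralD//; last 4 first.
- by move=> t _; rewrite lee_fin.
- exact: mE.
- by move=> t _; rewrite lee_fin.
- exact: mE.
rewrite (integral_normal_opp (mE _ mphi)); last by move=> t; rewrite lee_fin.
rewrite !int_sq ?addr_ge0//.
have : 0 <= \int[gauss]_t (phi t)%:E by apply: integral_ge0 => t _; rewrite lee_fin.
move: (\int[gauss]_t (phi t)%:E) => [r| |//] _; last by move=> _; exact: leey.
rewrite -!EFinD !lee_fin; lra.
Qed.

End normal_jensen.

Section sign_averages.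
Context {R : realType} {d : nat}.
Local Notation gauss := (@normal_prob R 0 1).
Implicit Types (h : 'rV[R]_d -> R) (v x : 'rV[R]_d) (vs : seq 'rV[R]_d).

(** The same expectation as [gauss_smooth], with independent fair signs in
    place of the normal variables. *)
Fixpoint sign_average h vs : 'rV[R]_d -> R :=
  if vs is v :: vs'
  then fun x => (sign_average h vs' (x + v) + sign_average h vs' (x - v)) / 2
  else h.

(** A weak form of the convexity of h (x + t v) + h (x - t v) in t ^ 2: a
    supporting line at t ^ 2 = 1, the only value of the square of a sign. It
    is stable under averages of translates of h. *)
Definition square_tangent h := forall x v, exists K, forall t,
  h (x + v) + h (x - v) + K * (t ^+ 2 - 1) <= h (x + t *: v) + h (x - t *: v).

Lemma square_tangent_sign_average h vs : square_tangent h ->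
  square_tangent (sign_average h vs).
Proof.
move=> hQ; elim: vs => [//|w vs IH] x v /=.
have [K1 H1] := IH (x + w) v; have [K2 H2] := IH (x - w) v.
exists ((K1 + K2) / 2) => t; have := H1 t; have := H2 t.
have swap a : (x + a + w = x + w + a) * (x + a - w = x - w + a) by split; exact: addrAC.
by rewrite !swap; lra.
Qed.

Lemma sign_average_ge0 h vs : (forall x, 0 <= h x) ->
  forall x, 0 <= sign_average h vs x.
Proof.
by move=> h0; elim: vs => [//|v vs IH] x /=; rewrite divr_ge0// addr_ge0.
Qed.

Lemma measurable_sign_average h vs : measurable_fun setT h ->
  measurable_fun setT (sign_average h vs).
Proof.
move=> mh; elim: vs => [//|v vs IH] /=.
apply: measurable_funM => //; apply: measurable_funD; apply: (measurableT_comp IH).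
  rewrite (_ : (fun _ => _) = (fun x => x + (cst 1 x : R) *: v)); last first.
    by apply/funext => x; rewrite scale1r.
  exact: measurable_row_line.
rewrite (_ : (fun _ => _) = (fun x => x + (cst (- 1) x : R) *: v)); last first.
  by apply/funext => x; rewrite scaleN1r.
exact: measurable_row_line.
Qed.

(** The signs are replaced one at a time, [normal_sqr_jensen] applying to the
    average over the signs not yet replaced. *)
Lemma sign_average_le_gauss_smooth h vs x : square_tangent h ->
  measurable_fun setT h -> (forall x, 0 <= h x) ->
  ((sign_average h vs x)%:E <= gauss_smooth (EFin \o h) vs x)%E.
Proof.
move=> hQ mh h0; elim: vs x => [x|v vs IH x] /=; first exact: lexx.
have [K KP] := square_tangent_sign_average vs hQ x v.
have mav := measurable_sign_average vs mh.
have line : measurable_fun setT (fun t : R => sign_average h vs (x + t *: v)).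
  by apply: (measurableT_comp mav); apply: measurable_row_line.
have av0 := sign_average_ge0 vs h0.
apply: (@le_trans _ _ (\int[gauss]_t (sign_average h vs (x + t *: v))%:E)%E).
  apply: (@normal_sqr_jensen _ _ _ K line) => //; first exact: addr_ge0.
  by move=> t; rewrite scaleNr; exact: KP.
have mEh : measurable_fun setT (EFin \o h) by exact/measurable_EFinP.
apply: ge0_le_integral => //.
- by move=> t _; rewrite lee_fin.
- exact/measurable_EFinP.
- apply: (measurableT_comp (measurable_gauss_smooth vs mEh _)).
    by move=> y; rewrite lee_fin.
  exact: measurable_row_line.
Qed.

End sign_averages.

(** * Sums of squares of normal variables *)

Section chi_smoothing.
Local Open Scope ereal_scope.
Context {R : realType}.
Local Notation gauss := (@normal_prob R 0 1).
Implicit Types F : R -> \bar R.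

(** The expectation of F (s + g_1 ^ 2 + ... + g_k ^ 2) for independent
    standard normal g_i; at s = 0 it is the integral of F against the
    chi-square law with k degrees of freedom. *)
Fixpoint chi_smooth F k : R -> \bar R :=
  if k is k'.+1 then fun s => \int[gauss]_g chi_smooth F k' (s + g ^+ 2)%R else F.

Lemma chi_smooth_ge0 F k : (forall s, 0 <= F s) -> forall s, 0 <= chi_smooth F k s.
Proof. by move=> F0; elim: k => [//|k IH] s /=; apply: integral_ge0. Qed.

Lemma measurable_chi_smooth F k : measurable_fun setT F -> (forall s, 0 <= F s) ->
  measurable_fun setT (chi_smooth F k).
Proof.
move=> mF F0; elim: k => [//|k IH] /=.
pose G (z : R * R) := chi_smooth F k (z.1 + z.2 ^+ 2)%R.
apply: (measurable_normal_integral (F := G)).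
  by apply: (measurableT_comp IH); apply: measurable_funD => //; exact: measurable_funX.
by move=> z; exact: chi_smooth_ge0.
Qed.

Let measurable_chi_step F k s : measurable_fun setT F -> (forall s, 0 <= F s) ->
  measurable_fun setT (fun g : R => chi_smooth F k (s + g ^+ 2)%R).
Proof.
move=> mF F0; apply: (measurableT_comp (measurable_chi_smooth k mF F0)).
exact: measurable_funD.
Qed.

Lemma chi_smooth_homo F k : measurable_fun setT F -> (forall s, 0 <= F s) ->
  {homo F : s t / (s <= t)%R >-> s <= t} ->
  {homo chi_smooth F k : s t / (s <= t)%R >-> s <= t}.
Proof.
move=> mF F0 hF; elim: k => [//|k IH] s t st /=.
apply: ge0_le_integral => //.
- by move=> g _; exact: chi_smooth_ge0.
- exact: measurable_chi_step.
- exact: measurable_chi_step.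
- by move=> g _; apply: IH; rewrite lerD2r.
Qed.

Lemma chi_smooth_le F k l s : measurable_fun setT F -> (forall s, 0 <= F s) ->
  {homo F : s t / (s <= t)%R >-> s <= t} -> (k <= l)%N ->
  chi_smooth F k s <= chi_smooth F l s.
Proof.
move=> mF F0 hF /subnK <-; elim: (l - k)%N => [//|m IH].
apply: (le_trans IH); rewrite addSn /=.
rewrite -[leLHS]integral_normal_cst.
apply: ge0_le_integral => //.
- by move=> g _; exact: chi_smooth_ge0.
- exact: measurable_chi_step.
- by move=> g _; apply: chi_smooth_homo => //; rewrite lerDl sqr_ge0.
Qed.

Lemma gauss_smooth_le_chi {d} (h : 'rV[R]_d -> \bar R) F vs x s :
  measurable_fun setT F -> (forall s, 0 <= F s) ->
  measurable_fun setT h -> (forall x, 0 <= h x) ->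
  (forall gs : seq R, size gs = size vs ->
    h (x + \sum_(p <- zip gs vs) p.1 *: p.2)%R <= F (s + \sum_(g <- gs) g ^+ 2)%R) ->
  gauss_smooth h vs x <= chi_smooth F (size vs) s.
Proof.
move=> mF F0 mh h0; elim: vs x s => [|v vs IH] x s hF /=.
  by have := hF [::] erefl; rewrite !big_nil !addr0.
apply: ge0_le_integral => //.
- by move=> g _; exact: gauss_smooth_ge0.
- apply: (measurableT_comp (measurable_gauss_smooth vs mh h0)).
  exact: measurable_row_line.
- exact: measurable_chi_step.
- move=> g _; apply: IH => gs gsvs.
  have := hF (g :: gs); rewrite /= gsvs => /(_ erefl).
  by rewrite !big_cons !addrA.
Qed.

End chi_smoothing.

(** * Integration of functions of independent variables *)

Section pushforward_finite.
Local Open Scope ereal_scope.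
Context d1 d2 (T : measurableType d1) (U : measurableType d2) (R : realType).
Variables (mu : {finite_measure set T -> \bar R}) (X : T -> U).
Hypothesis mX : measurable_fun setT X.

(** The proof of measurability is an argument of the term, so that the
    structure of finite measure can be inferred from it. *)
Definition finite_pushforward & measurable_fun setT X := pushforward mu X.
Local Notation law := (finite_pushforward mX).

Let law0 : law set0 = 0.
Proof. by rewrite /finite_pushforward /pushforward preimage_set0 measure0. Qed.

Let law_ge0 A : 0 <= law A.
Proof. exact: measure_ge0. Qed.

Let law_sigma_additive : semi_sigma_additive law.
Proof. exact: (@measure_semi_sigma_additive _ _ _ (pushforward mu X)). Qed.

HB.instance Definition _ :=
  isMeasure.Build _ _ _ law law0 law_ge0 law_sigma_additive.

Let law_fin : fin_num_fun law.
Proof.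
move=> A mA; apply: fin_num_measure; rewrite -[_ @^-1` _]setTI; exact: mX.
Qed.

HB.instance Definition _ := Measure_isFinite.Build _ _ _ law law_fin.

Lemma integral_finite_pushforward (f : U -> \bar R) : measurable_fun setT f ->
  (forall u, 0 <= f u) -> \int[law]_u f u = \int[mu]_t f (X t).
Proof. by move=> mf f0; rewrite ge0_integral_pushforward. Qed.

End pushforward_finite.

Section independent_pair.
Local Open Scope ereal_scope.
Context d1 d2 d3 (T : measurableType d1) (U : measurableType d2)
  (V : measurableType d3) (R : realType).
Variables (mu : {finite_measure set T -> \bar R})
  (rho : {finite_measure set V -> \bar R})
  (X : T -> U) (Z : T -> V).
Hypotheses (mX : measurable_fun setT X) (mZ : measurable_fun setT Z).

(** A measure on a product that agrees with the product measure on rectangles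
    is equal to it; the theorem of Tonelli then applies. *)
Lemma integral_independent_pair (F : U * V -> \bar R) :
  (forall A B, measurable A -> measurable B ->
    mu ((X @^-1` A) `&` (Z @^-1` B)) = mu (X @^-1` A) * rho B) ->
  measurable_fun setT F -> (forall z, 0 <= F z) ->
  \int[mu]_t F (X t, Z t) = \int[mu]_t \int[rho]_z F (X t, z).
Proof.
move=> XZ mF F0.
have mXZ : measurable_fun setT (fun t => (X t, Z t)) by exact: measurable_fun_pair.
rewrite -(integral_finite_pushforward mu mXZ mF F0).
have mG := measurable_fun_fubini_tonelli_F (m2 := rho) F mF F0.
rewrite -(integral_finite_pushforward mu mX mG); last first.
  by move=> u; apply: integral_ge0.
rewrite -fubini_tonelli1//.
apply: eq_measure_integral => A mA _; apply/esym.
by apply: product_measure_unique => // B C mB mC; exact: XZ.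
Qed.

End independent_pair.

Section independent_walk.
Local Open Scope ereal_scope.
Context d1 d2 d3 (T : measurableType d1) (V : measurableType d2)
  (U : measurableType d3) (R : realType) (I : finType).
Variables (Q : probability T R) (Z : I -> T -> V) (rho : I -> probability V R)
  (step : I -> U * V -> U).
Hypotheses (mZ : forall i, measurable_fun setT (Z i))
  (lawZ : forall i B, measurable B -> Q (Z i @^-1` B) = rho i B)
  (indepZ : mutually_independent Q Z)
  (mstep : forall i, measurable_fun setT (step i)).
Implicit Types (s : seq I) (psi : U -> \bar R) (u : U) (J : {set I}).

(** A process driven by the variables Z i. Sums of signed vectors and sums of
    squares are both of this form. *)
Definition walk s u (t : T) := foldl (fun u i => step i (u, Z i t)) u s.

Definition walk_integral s psi : U -> \bar R :=
  foldr (fun i psi u => \int[rho i]_z psi (step i (u, z))) psi s.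

Lemma walk_rcons s i u t : walk (rcons s i) u t = step i (walk s u t, Z i t).
Proof. by rewrite /walk foldl_rcons. Qed.

Lemma walk_integral_rcons s i psi : walk_integral (rcons s i) psi =
  walk_integral s (fun u => \int[rho i]_z psi (step i (u, z))).
Proof. by rewrite /walk_integral foldr_rcons. Qed.

Lemma measurable_walk s u : measurable_fun setT (walk s u).
Proof.
elim/last_ind: s => [|s i IH]; first exact: measurable_cst.
rewrite (_ : walk _ _ = fun t => step i (walk s u t, Z i t)); last first.
  by apply/funext => t; rewrite walk_rcons.
by apply: (measurableT_comp (mstep i)); exact: measurable_fun_pair.
Qed.

Let event J (A : I -> set V) := \bigcap_(i in [set` J]) (Z i @^-1` A i).

Let measurable_event J A : (forall i, measurable (A i)) -> measurable (event J A).
Proof.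
move=> mA; apply: fin_bigcap_measurable => // i _.
by rewrite -[X in measurable X]setTI; exact: mZ.
Qed.

(** The event constraining the variables outside s makes the induction go
    through: adding i to s calls the induction hypothesis on an event that
    also constrains Z i, and this shows that Z i is independent of the walk so
    far and of the event. *)
Let restricted_walk s u J A (mA : forall i, measurable (A i)) psi :
  uniq s -> (forall i, i \in s -> i \notin J) ->
  measurable_fun setT psi -> (forall u, 0 <= psi u) ->
  \int[mrestr Q (measurable_event J mA)]_t psi (walk s u t) =
  Q (event J A) * walk_integral s psi u.
Proof.
elim/last_ind: s J A mA psi => [|s i IH] J A mA psi.
  by move=> _ _ mpsi psi0; rewrite /walk /= integral_cst//= /mrestr setTI muleC.
rewrite rcons_uniq => /andP[is_ us] sJ mpsi psi0.
have iJ : i \notin J by apply: sJ; rewrite mem_rcons mem_head.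
have {}sJ j : j \in s -> j \notin J.
  by move=> js; apply: sJ; rewrite mem_rcons inE js orbT.
have IHindic J' A' (mA' : forall i, measurable (A' i)) B : measurable B ->
    (forall j, j \in s -> j \notin J') ->
    Q (walk s u @^-1` B `&` event J' A') =
    Q (event J' A') * walk_integral s (fun u => (\1_B u)%:E) u.
  move=> mB sJ'.
  have mind : measurable_fun setT (fun v : U => (\1_B v)%:E : \bar R).
    by apply/measurable_EFinP; exact: measurable_indic.
  have ind0 (v : U) : 0 <= (\1_B v)%:E :> \bar R by rewrite lee_fin.
  rewrite -(IH _ _ mA' _ us sJ' mind ind0).
  have mwB : measurable (walk s u @^-1` B).
    by rewrite -[X in measurable X]setTI; exact: measurable_walk.
  transitivity (mrestr Q (measurable_event J' mA') (walk s u @^-1` B)); first by [].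
  rewrite -[X in mrestr _ _ X]setIT.
  by rewrite -(integral_indic (mrestr Q (measurable_event J' mA')) measurableT mwB).
have mpsii : measurable_fun setT (psi \o step i) by exact: measurableT_comp.
have mint : measurable_fun setT (fun v => \int[rho i]_z psi (step i (v, z))).
  exact: (measurable_fun_fubini_tonelli_F (m2 := rho i) _ mpsii (fun=> psi0 _)).
have int0 v : 0 <= \int[rho i]_z psi (step i (v, z)) by exact: integral_ge0.
rewrite walk_integral_rcons -(IH _ _ mA _ us sJ mint int0).
under eq_integral do rewrite walk_rcons.
apply: (integral_independent_pair (measurable_walk s u) (mZ i) _ mpsii (fun=> psi0 _)).
move=> B C mB mC; rewrite /= /mrestr.
  pose A' j := if j == i then C else A j.
  have mA' j : measurable (A' j) by rewrite /A'; case: ifP.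
  have A'J j : j \in J -> A' j = A j.
    by move=> jJ; rewrite /A'; case: eqP => // ji; rewrite -ji jJ in iJ.
  have eventE : Z i @^-1` C `&` event J A = event (i |: J)%SET A'.
    apply/seteqP; split => [t [Ct At] j /=|t At].
      by rewrite in_setU1 => /orP[/eqP ->|jJ]; rewrite /A' ?eqxx// -/(A' j) A'J//; exact: At.
    split; first by have := At i; rewrite /A' /= eqxx; apply; rewrite setU11.
    by move=> j /= jJ; rewrite -A'J//; apply: At => /=; rewrite in_setU1 jJ orbT.
  rewrite -setIA eventE !IHindic//; last first.
    by move=> j js; rewrite in_setU1 negb_or sJ// andbT; apply: contraNneq is_ => <-.
  rewrite muleAC; congr (_ * _); rewrite /event !indepZ// big_setU1//= muleC.
  rewrite /A' eqxx lawZ//; congr (_ * _); apply: eq_bigr => j jJ.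
  by rewrite -/(A' j) A'J.
Qed.

Lemma integral_walk s u psi : uniq s -> measurable_fun setT psi ->
  (forall u, 0 <= psi u) ->
  \int[Q]_t psi (walk s u t) = walk_integral s psi u.
Proof.
move=> us mpsi psi0.
have mA (i : I) : measurable [set: V] by [].
have event0 : event finset.set0 (fun=> setT) = setT.
  by apply/seteqP; split => // t _ i /=; rewrite inE.
have event1 : Q (event finset.set0 (fun=> setT)) = 1 by rewrite event0 probability_setT.
have s0 i : i \in s -> i \notin (finset.set0 : {set I}) by rewrite inE.
have := restricted_walk u (J := finset.set0) mA us s0 mpsi psi0.
rewrite event1 mul1e => <-.
by apply: eq_measure_integral => A _ _; rewrite /= /mrestr event0 setIT.
Qed.

End independent_walk.

(** * Regularized quadratic forms *)

Section bilinear_forms.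
Context {R : realType} {d : nat}.
Implicit Types (S : 'M[R]_d) (v w y : 'rV[R]_d) (vs : seq 'rV[R]_d) (e : R).

Definition bilin S v w : R := (v *m S *m w^T) ord0 ord0.

Definition dot v w : R := (v *m w^T) ord0 ord0.

Definition psd S := S^T = S /\ forall v, 0 <= bilin S v v.

Lemma bilinDl S v v' w : bilin S (v + v') w = bilin S v w + bilin S v' w.
Proof. by rewrite /bilin !mulmxDl mxE. Qed.

Lemma bilinDr S v w w' : bilin S v (w + w') = bilin S v w + bilin S v w'.
Proof. by rewrite /bilin linearD /= mulmxDr mxE. Qed.

Lemma bilinZl S a v w : bilin S (a *: v) w = a * bilin S v w.
Proof. by rewrite /bilin -!scalemxAl mxE. Qed.

Lemma bilinZr S a v w : bilin S v (a *: w) = a * bilin S v w.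
Proof. by rewrite /bilin linearZ /= -scalemxAr mxE. Qed.

Lemma bilinC S v w : S^T = S -> bilin S v w = bilin S w v.
Proof.
move=> SS; rewrite /bilin.
have -> : w *m S *m v^T = (v *m S *m w^T)^T by rewrite !trmx_mul trmxK SS mulmxA.
by rewrite [RHS]mxE.
Qed.

Lemma bilin_line S x v t : S^T = S -> bilin S (x + t *: v) (x + t *: v) =
  bilin S x x + 2 * bilin S x v * t + bilin S v v * t ^+ 2.
Proof.
move=> SS; rewrite !(bilinDl, bilinDr, bilinZl, bilinZr) (bilinC v x SS); ring.
Qed.

(** The minimum of the polynomial is at t = - b / c when c > 0; when c = 0, an
    affine function bounded below is constant. *)
Lemma quadratic_ge0_discriminant (a b c : R) : 0 <= c ->
  (forall t, 0 <= a + 2 * b * t + c * t ^+ 2) -> b ^+ 2 <= a * c.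
Proof.
rewrite le_eqVlt => /predU1P[<-|c0] q.
  have [->|b0] := eqVneq b 0; first by rewrite expr0n mulr0.
  have := q (- (a + 1) / (2 * b)); rewrite mul0r addr0.
  rewrite (_ : _ + _ = - 1); first by rewrite oppr_ge0 ler10.
  by field.
have := q (- b / c); rewrite (_ : _ + _ = (a * c - b ^+ 2) / c); last first.
  by field; exact: lt0r_neq0.
by rewrite ler_pdivlMr// mul0r subr_ge0.
Qed.

Lemma psd_cauchy_schwarz S v w : psd S -> bilin S v w ^+ 2 <= bilin S v v * bilin S w w.
Proof.
move=> [SS S0]; apply: quadratic_ge0_discriminant => // t.
by rewrite -bilin_line.
Qed.

Lemma dotE v w : dot v w = \sum_i v ord0 i * w ord0 i.
Proof. by rewrite /dot mxE; apply: eq_bigr => i _; rewrite mxE. Qed.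

Lemma dotC v w : dot v w = dot w v.
Proof. by rewrite !dotE; apply: eq_bigr => i _; rewrite mulrC. Qed.

Lemma dot_ge0 v : 0 <= dot v v.
Proof. by rewrite dotE; apply: sumr_ge0 => i _; rewrite -expr2 sqr_ge0. Qed.

Lemma dot_eq0 v : dot v v = 0 -> v = 0.
Proof.
rewrite dotE => /eqP; rewrite psumr_eq0 => [/allP v0|i _]; last by rewrite -expr2 sqr_ge0.
apply/rowP => i; rewrite mxE; apply/eqP; have := v0 i (mem_index_enum _).
by rewrite /= -expr2 sqrf_eq0.
Qed.

Lemma dot_suml I (r : seq I) (F : I -> 'rV[R]_d) w :
  dot (\sum_(i <- r) F i) w = \sum_(i <- r) dot (F i) w.
Proof. by rewrite /dot mulmx_suml summxE. Qed.

Lemma dotZl a v w : dot (a *: v) w = a * dot v w.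
Proof. by rewrite /dot -scalemxAl mxE. Qed.

Lemma bilin_gram vs v w : bilin (gram vs) v w = \sum_(x <- vs) dot x v * dot x w.
Proof.
rewrite /bilin /gram mulmx_sumr mulmx_suml summxE; apply: eq_bigr => x _.
by rewrite mulmxA -mulmxA mxE big_ord1 -/(dot _ _) -/(dot x w) dotC.
Qed.

Lemma psd_gram vs : psd (gram vs).
Proof.
split; last by move=> v; rewrite bilin_gram sumr_ge0// => x _; rewrite -expr2 sqr_ge0.
by rewrite /gram raddf_sum; apply: eq_bigr => x _ /=; rewrite trmx_mul trmxK.
Qed.

End bilinear_forms.

Section ridge.
Context {R : realType} {d : nat}.
Implicit Types (S : 'M[R]_d) (v w y : 'rV[R]_d) (vs : seq 'rV[R]_d) (e : R).

Definition ridge S e y := bilin (invmx (S + e%:M)) y y.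

Let bilin_shift S e v w : bilin (S + e%:M) v w = bilin S v w + e * dot v w.
Proof.
by rewrite /bilin mulmxDr mulmxDl mxE mul_mx_scalar -scalemxAl [X in _ + X]mxE.
Qed.

Lemma ridge_unit S e : psd S -> 0 < e -> S + e%:M \in unitmx.
Proof.
move=> [_ S0] e0; rewrite -row_free_unit -kermx_eq0; apply/eqP/row_matrixP => i.
set v := row i _; have vA : v *m (S + e%:M) = 0 by rewrite /v -row_mul mulmx_ker row0.
rewrite row0; apply: dot_eq0.
have : bilin (S + e%:M) v v = 0 by rewrite /bilin vA mul0mx mxE.
rewrite bilin_shift => h; have := S0 v; have := dot_ge0 v => d0 s0.
have /eqP : e * dot v v = 0.
  by apply/le_anti; rewrite mulr_ge0// ?(ltW e0)// andbT; lra.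
by rewrite mulf_eq0 gt_eqF//= => /eqP.
Qed.

Variables (S : 'M[R]_d) (e : R).
Hypotheses (psdS : psd S) (e0 : 0 < e).
Let A := S + e%:M.
Let B := invmx A.

Let unitA : A \in unitmx. Proof. exact: ridge_unit. Qed.

Let symA : A^T = A.
Proof. by rewrite /A linearD /= tr_scalar_mx; have [-> _] := psdS. Qed.

Let symB : B^T = B.
Proof. by rewrite /B trmx_inv symA. Qed.

Let ridgeE y : ridge S e y = dot y (y *m B).
Proof. by rewrite /dot trmx_mul symB mulmxA. Qed.

Let bilinAB y w : bilin A (y *m B) w = dot y w.
Proof. by rewrite /bilin mulmxKV. Qed.

Let A_ge0 v : 0 <= bilin A v v.
Proof.
have [_ S0] := psdS; rewrite bilin_shift addr_ge0// mulr_ge0 ?dot_ge0//.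
exact: ltW.
Qed.

(** The form S + e is nonnegative at the vector y (S + e)^-1 - w. *)
Lemma ridge_variational y w : 2 * dot y w - bilin S w w - e * dot w w <= ridge S e y.
Proof.
have := A_ge0 (y *m B + (- 1) *: w); rewrite bilin_line// !bilinAB -ridgeE.
rewrite bilin_shift; lra.
Qed.

(** Together with [ridge_variational]: the form is a maximum over w of
    expressions that are affine in S and e, from which its monotonicity in e
    and its upper bounds can be read off. *)
Lemma ridge_attained y : exists w,
  ridge S e y = 2 * dot y w - bilin S w w - e * dot w w.
Proof.
exists (y *m B); have := bilinAB y (y *m B); rewrite bilin_shift -ridgeE; lra.
Qed.

Lemma psd_ridge : psd (invmx (S + e%:M)).
Proof.
split; first exact: symB.
move=> v; have dot0 u : dot u 0 = 0 by rewrite /dot trmx0 mulmx0 mxE.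
have bilin0 : bilin S 0 0 = 0 by rewrite /bilin !mul0mx mxE.
by have := ridge_variational v 0; rewrite !dot0 bilin0 !mulr0 !subr0.
Qed.

Lemma ridge_ge0 y : 0 <= ridge S e y.
Proof. by have [_] := psd_ridge; apply. Qed.

End ridge.

Section ridge_bounds.
Context {R : realType} {d : nat}.
Implicit Types (S : 'M[R]_d) (v w y : 'rV[R]_d) (vs : seq 'rV[R]_d) (e : R).

Lemma ridge_anti S e e' y : psd S -> 0 < e -> e <= e' -> ridge S e' y <= ridge S e y.
Proof.
move=> psdS e0 ee'; have [w ->] := ridge_attained psdS (lt_le_trans e0 ee') y.
apply: le_trans (ridge_variational psdS e0 y w).
by rewrite lerD2l lerN2 ler_wpM2r// dot_ge0.
Qed.

(** With u_i the inner product of the i-th vector with the maximizer w, the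
    variational formula is at most a sum of terms 2 g_i u_i - u_i ^ 2 <= g_i ^
    2. *)
Lemma ridge_le_sqr e vs (gs : seq R) : 0 < e -> size gs = size vs ->
  ridge (gram vs) e (\sum_(p <- zip gs vs) p.1 *: p.2) <= \sum_(g <- gs) g ^+ 2.
Proof.
move=> e0 gsvs; have [w ->] := ridge_attained (psd_gram vs) e0 (\sum_(p <- zip gs vs) p.1 *: p.2).
have gE : gs = [seq p.1 | p <- zip gs vs] by rewrite -/(unzip1 _) unzip1_zip// gsvs.
have vE : vs = [seq p.2 | p <- zip gs vs] by rewrite -/(unzip2 _) unzip2_zip// gsvs.
have edot : 0 <= e * dot w w by rewrite mulr_ge0 ?dot_ge0// ltW.
rewrite lerBlDr (@le_trans _ _ (\sum_(g <- gs) g ^+ 2))//; last by rewrite lerDl.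
have -> : \sum_(g <- gs) g ^+ 2 = \sum_(p <- zip gs vs) p.1 ^+ 2.
  by rewrite [in LHS]gE big_map.
have -> : bilin (gram vs) w w = \sum_(p <- zip gs vs) dot p.2 w * dot p.2 w.
  by rewrite bilin_gram [in LHS]vE big_map.
rewrite dot_suml mulr_sumr -sumrB.
apply: ler_sum => -[g v] _ /=; rewrite dotZl.
have := sqr_ge0 (g - dot v w); lra.
Qed.

End ridge_bounds.

Section ridge_measurability.
Context {R : realType} {disp : measure_display} {T : measurableType disp}.

Lemma measurable_mulmx m n p (f : T -> 'M[R]_(m, n)) (g : T -> 'M[R]_(n, p)) :
  (forall i j, measurable_fun setT (fun t => f t i j)) ->
  (forall i j, measurable_fun setT (fun t => g t i j)) ->
  forall i j, measurable_fun setT (fun t => (f t *m g t) i j).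
Proof.
move=> mf mg i j; under eq_fun do rewrite mxE.
by apply: measurable_sum => k; exact: measurable_funM.
Qed.

Lemma measurable_determinant n (f : T -> 'M[R]_n) :
  (forall i j, measurable_fun setT (fun t => f t i j)) ->
  measurable_fun setT (fun t => \det (f t)).
Proof.
move=> mf; rewrite /determinant; apply: measurable_sum => s.
by apply: measurable_funM => //; apply: measurable_prod.
Qed.

Lemma measurable_inv : measurable_fun setT (fun x : R => x^-1).
Proof.
(* The real power is used at a nonnegative base only; both sides are 0 at 0. *)
rewrite (_ : (fun _ => _) = (fun x : R => x * (x ^+ 2) `^ (- 1))); last first.
  apply/funext => x; rewrite powR_inv1 ?sqr_ge0//.
  have [->|x0] := eqVneq x 0; first by rewrite invr0 mul0r.
  by field.
apply: measurable_funM => //.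
by apply: (measurableT_comp (f := fun y : R => y `^ (- 1)) (g := fun x : R => x ^+ 2)).
Qed.

(** By the formula of Cramer, the entries of the inverse are quotients of
    determinants. *)
Lemma measurable_ridge d (S : T -> 'M[R]_d) (y : T -> 'rV[R]_d) e :
  (forall t, psd (S t)) -> 0 < e ->
  (forall i j, measurable_fun setT (fun t => S t i j)) ->
  (forall i j, measurable_fun setT (fun t => y t i j)) ->
  measurable_fun setT (fun t => ridge (S t) e (y t)).
Proof.
move=> psdS e0 mS my.
have mA i j : measurable_fun setT (fun t => (S t + e%:M) i j).
  under eq_fun do rewrite mxE.
  exact: measurable_funD.
apply: measurable_mulmx; last first.
  move=> i j; rewrite (_ : (fun _ => _) = fun t => y t j i); first exact: my.
  by apply/funext => t; rewrite mxE.
apply: measurable_mulmx => // i j.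
under eq_fun => t do rewrite /invmx (ridge_unit (psdS t) e0) !mxE.
apply: measurable_funM.
  apply: (measurableT_comp measurable_inv); exact: measurable_determinant.
apply: measurable_funM => //; apply: measurable_determinant => k l.
rewrite (_ : (fun _ => _) = fun t => (S t + e%:M) (lift j k) (lift i l)).
  exact: mA.
by apply/funext => t; rewrite 2!mxE.
Qed.

End ridge_measurability.

(** * Comparison for a fixed Gram matrix *)

Section comparison.
Context {R : realType} (f : R -> R).
Hypothesis hf : C2_up_conv f.

Definition sqrt_comp (s : R) : R := f (Num.sqrt s).

Lemma sqrt_comp_ge0 s : 0 <= sqrt_comp s.
Proof. exact: C2_up_conv_ge0 hf _ (sqrtr_ge0 s). Qed.

Lemma sqrt_comp_homo : {homo sqrt_comp : s t / s <= t}.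
Proof.
by move=> s t st; apply: C2_up_conv_le hf _ _ (sqrtr_ge0 s) _; exact: ler_wsqrtr.
Qed.

Lemma sqrt_comp_continuous : continuous sqrt_comp.
Proof.
move=> s; apply: (@continuous_comp _ _ _ Num.sqrt f s).
  exact: sqrt_continuous.
exact: C2_up_conv_continuous hf _.
Qed.

Lemma measurable_sqrt_comp : measurable_fun setT sqrt_comp.
Proof. exact: continuous_measurable_fun sqrt_comp_continuous. Qed.

(** On a line the form is a quadratic polynomial, and its discriminant
    condition is the Cauchy-Schwarz inequality. *)
Lemma sqrt_comp_ridge_tangent d (S : 'M[R]_d) e : psd S -> 0 < e ->
  square_tangent (fun y => sqrt_comp (ridge S e y)).
Proof.
move=> psdS e0 x v; have psdB := psd_ridge psdS e0; have [symB _] := psdB.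
have [K KP] := C2_up_conv_quadratic_tangent hf
  (ridge_ge0 psdS e0 x) (ridge_ge0 psdS e0 v) (psd_cauchy_schwarz x v psdB).
exists K => t.
have line u : ridge S e (x + u *: v) = ridge S e x
    + 2 * bilin (invmx (S + e%:M)) x v * u + ridge S e v * u ^+ 2.
  exact: bilin_line.
have lineN u : ridge S e (x - u *: v) = ridge S e x
    - 2 * bilin (invmx (S + e%:M)) x v * u + ridge S e v * u ^+ 2.
  by rewrite -scaleNr line; ring.
have := line 1; have := lineN 1; rewrite scale1r !mulr1 expr1n mulr1 => E1 E2.
by rewrite /sqrt_comp line lineN E1 E2; exact: KP.
Qed.

Lemma measurable_row_ridge d (S : 'M[R]_d) e : psd S -> 0 < e ->
  measurable_fun setT (ridge S e).
Proof.
move=> psdS e0; apply: (measurable_ridge (S := fun=> S)) => //.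
by move=> i j; exact: measurable_matrix_entry.
Qed.

(** Signs are replaced by normal variables, which are then reduced to at most
    d of them without changing the Gram matrix; the form is then at most the
    sum of their squares. *)
Lemma sign_average_ridge_le_chi d (vs : seq 'rV[R]_d) e : 0 < e ->
  ((sign_average (fun y => sqrt_comp (ridge (gram vs) e y)) vs 0)%:E <=
   chi_smooth (EFin \o sqrt_comp) d 0)%E.
Proof.
move=> e0; set h := fun y => _; have psdS := psd_gram vs.
have mh : measurable_fun setT h.
  by apply: (measurableT_comp measurable_sqrt_comp); exact: measurable_row_ridge.
have h0 y : 0 <= h y by exact: sqrt_comp_ge0.
have mEh : measurable_fun setT (EFin \o h) by exact/measurable_EFinP.
have mF : measurable_fun setT (EFin \o sqrt_comp).
  by apply/measurable_EFinP; exact: measurable_sqrt_comp.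
have F0 s : (0 <= (EFin \o sqrt_comp) s)%E by rewrite lee_fin sqrt_comp_ge0.
apply: (le_trans (sign_average_le_gauss_smooth vs 0 (sqrt_comp_ridge_tangent psdS e0) mh h0)).
have [ws wsd [gramE ->//]] := gauss_reduce vs.
apply: (@le_trans _ _ (chi_smooth (EFin \o sqrt_comp) (size ws) 0)).
  apply: gauss_smooth_le_chi => // gs gsws.
  rewrite !add0r /= lee_fin /h gramE.
  by apply: sqrt_comp_homo; exact: ridge_le_sqr.
apply: chi_smooth_le => // s t st; rewrite /= lee_fin; exact: sqrt_comp_homo.
Qed.

End comparison.

(** * Laws of signed sums and of chi-square variables *)

Section sign_laws.
Context {R : realType} {disp : measure_display} {T : measurableType disp}.
Variables (Q : probability T R) (n : nat) (eps : 'I_n -> {RV Q >-> R}).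
Hypotheses (eps_sign : forall i, fair_sign Q (eps i))
  (eps_indep : mutually_independent Q (fun i => eps i : T -> R)).

Lemma fair_sign_ae : {ae Q, forall t i, eps i t = 1 \/ eps i t = -1}.
Proof.
apply: filter_forall => i.
pose A := eps i @^-1` [set 1]; pose B := eps i @^-1` [set (-1 : R)].
have mA : measurable A by exact: measurable_funPTI.
have mB : measurable B by exact: measurable_funPTI.
have [QA QB] := eps_sign i.
have AB : A `&` B = set0.
  apply/seteqP; split => // t [t1 tN1].
  have : (1 : R) = -1 by rewrite -[LHS]t1.
  by lra.
exists (~` (A `|` B)); split.
- by apply: measurableC; exact: measurableU.
- have QU : Q (A `|` B) = 1%E.
    by rewrite measureU// [X in (X + _)%E]QA [X in (_ + X)%E]QB -EFinD; congr EFin; field.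
  by rewrite probability_setC ?QU ?subee//; exact: measurableU.
- by move=> t /= nt [h|h]; apply: nt; [left|right].
Qed.

Lemma integral_fair_sign i (phi : R -> R) : measurable_fun setT phi ->
  (forall z, 0 <= phi z) ->
  (\int[distribution Q (eps i)]_z (phi z)%:E = ((phi 1 + phi (- 1)) / 2)%:E)%E.
Proof.
move=> mphi phi0; pose rho : probability _ R := distribution Q (eps i).
transitivity (\int[rho]_z (phi z)%:E)%E; first by [].
have [rho1 rho1N] := eps_sign i.
have neq : (-1 : R) != 1 by apply/eqP; lra.
have mE : measurable_fun setT (EFin \o phi) by exact/measurable_EFinP.
pose A := [set (1 : R)] `|` [set -1].
have mA : measurable A by exact: measurableU.
have disj0 : [set (1 : R)] `&` [set -1] = set0.
  by apply/seteqP; split => // z [/= -> /eqP]; rewrite eq_sym (negbTE neq).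
have disj : [disjoint [set (1 : R)] & [set -1]].
  by apply/disj_setPS; rewrite disj0.
have rhoA : rho A = 1%E.
  rewrite /A measureU//.
  by rewrite [X in (X + _)%E]rho1 [X in (_ + X)%E]rho1N -EFinD; congr EFin; field.
have rhoAC : rho (~` A) = 0%E by rewrite probability_setC// rhoA subee.
have dirac_int (a : R) : rho [set a] = (2^-1)%:E ->
    (\int[rho]_(z in [set a]) (phi z)%:E = (phi a / 2)%:E)%E.
  move=> rhoa; rewrite (eq_integral (cst (phi a)%:E)); last first.
    by move=> z; rewrite inE /= => ->.
  by rewrite integral_cst// [X in (_ * X)%E]rhoa -EFinM.
rewrite -(setUv A) ge0_integral_setU//; last 4 first.
- exact: measurableC.
- by rewrite setUv.
- by move=> z _; rewrite lee_fin.
- by apply/disj_setPS; rewrite setICr.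
rewrite [X in (_ + X)%E]null_set_integral//; last 2 first.
- exact: measurableC.
- exact: measurable_funTS.
rewrite adde0 ge0_integral_setU//; last 2 first.
- exact: measurable_funTS.
- by move=> z _; rewrite lee_fin.
by rewrite (dirac_int _ rho1) (dirac_int _ rho1N) -EFinD; congr EFin; field.
Qed.

Lemma expectation_signed_sum d (h : 'rV[R]_d -> R) (y : 'I_n -> 'rV[R]_d) :
  measurable_fun setT h -> (forall x, 0 <= h x) ->
  (\int[Q]_t (h (\sum_i eps i t *: y i))%:E =
   (sign_average h [seq y i | i <- enum 'I_n] 0)%:E)%E.
Proof.
move=> mh h0.
pose step i (uz : 'rV[R]_d * R) := uz.1 + uz.2 *: y i.
have mstep i : measurable_fun setT (step i) by exact: measurable_row_line.
have walkE s u t : walk (fun i => eps i : T -> R) step s u t =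
    u + \sum_(i <- s) eps i t *: y i.
  elim: s u => [|i s IH] u; first by rewrite big_nil addr0.
  by rewrite big_cons addrA; exact: IH.
have mEh : measurable_fun setT (EFin \o h) by exact/measurable_EFinP.
have Eh0 x : (0 <= (EFin \o h) x)%E by rewrite lee_fin.
have walk_intE s : walk_integral (fun i => distribution Q (eps i)) step s (EFin \o h) =
    EFin \o sign_average h [seq y i | i <- s].
  elim: s => [//|i s IH]; apply/funext => u.
  transitivity (\int[distribution Q (eps i)]_z
      (sign_average h [seq y i | i <- s] (step i (u, z)))%:E)%E.
    by apply: eq_integral => z _; exact: (congr1 (@^~ (step i (u, z))) IH).
  rewrite (integral_fair_sign i (phi := fun z => sign_average h [seq y i | i <- s] (step i (u, z)))).
  - by rewrite /step /= scale1r scaleN1r.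
  - apply: (measurableT_comp (measurable_sign_average _ mh)).
    exact: (measurable_row_line (u := fun=> u) (g := fun z : R => z)).
  - by move=> z; exact: sign_average_ge0.
have := integral_walk (rho := fun i => distribution Q (eps i)) (step := step)
  (fun i => measurable_funPT (eps i)) (fun i B mB => erefl) eps_indep mstep 0
  (enum_uniq 'I_n) mEh Eh0.
rewrite walk_intE /= => <-; apply: eq_integral => t _.
by rewrite walkE add0r big_enum.
Qed.

End sign_laws.

Section chi_law.
Context {R : realType} {disp : measure_display} {T : measurableType disp}.

Lemma same_law_integral d1 d2 d3 (T1 : measurableType d1) (T2 : measurableType d2)
    (U : measurableType d3) (P : probability T1 R) (Q : probability T2 R)
    (X : T1 -> U) (Y : T2 -> U) (psi : U -> \bar R) :
  measurable_fun setT X -> measurable_fun setT Y -> same_law P Q X Y ->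
  measurable_fun setT psi -> (forall u, 0 <= psi u)%E ->
  (\int[P]_t psi (X t) = \int[Q]_t psi (Y t))%E.
Proof.
move=> mX mY XY mpsi psi0.
rewrite -(integral_finite_pushforward P mX mpsi psi0).
rewrite -(integral_finite_pushforward Q mY mpsi psi0).
by apply: eq_measure_integral => A mA _; exact: XY.
Qed.

Lemma chi_square_integral (P : probability T R) (d : nat) (C : {RV P >-> R})
    (F : R -> \bar R) : chi_square d C ->
  measurable_fun setT F -> (forall s, 0 <= F s)%E ->
  (\int[P]_t F (C t) = chi_smooth F d 0)%E.
Proof.
move=> [disp' [T' [Q [Z [lawZ indepZ lawC]]]]] mF F0.
have mZ i : measurable_fun setT (Z i : T' -> R) by [].
rewrite (same_law_integral _ _ lawC)//; last first.
  by apply: measurable_sum => i; exact: measurable_funX.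
pose step (i : 'I_d) (sz : R * R) := sz.1 + sz.2 ^+ 2.
have mstep i : measurable_fun setT (step i).
  by apply: measurable_funD => //; exact: measurable_funX.
have walkE s u t : walk (fun i => Z i : T' -> R) step s u t =
    u + \sum_(i <- s) Z i t ^+ 2.
  elim: s u => [|i s IH] u; first by rewrite big_nil addr0.
  by rewrite big_cons addrA; exact: IH.
have walk_intE s : walk_integral (fun=> normal_prob 0 1) step s F =
    chi_smooth F (size s).
  elim: s => [//|i s IH]; apply/funext => u.
  by apply: eq_integral => z _; exact: (congr1 (@^~ (step i (u, z))) IH).
have := integral_walk (rho := fun=> normal_prob 0 1) (step := step)
  mZ lawZ indepZ mstep 0 (enum_uniq 'I_d) mF F0.
rewrite walk_intE size_enum_ord => <-; apply: eq_integral => t _.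
have E := walkE (enum 'I_d) 0 t; rewrite add0r big_enum /= in E.
by congr F; rewrite -E.
Qed.

End chi_law.

(** * The regularized statistic *)

Section regularized_statistic.
Context {R : realType} {n d : nat}.
Implicit Types (x : 'I_n -> 'rV[R]_d) (M : 'M[R]_(n, d)).

Definition regularized_Rsquare x e : R :=
  (sample_mean x *m invmx (sample_second_moment x + e%:M) *m (sample_mean x)^T) ord0 ord0.

Definition matrix_rows M : seq 'rV[R]_d := [seq row i M | i <- enum 'I_n].

Definition row_ridge e M : R := ridge (gram (matrix_rows M)) e (\sum_i row i M).

Lemma gram_rows M : gram (matrix_rows M) = \sum_i (row i M)^T *m row i M.
Proof. by rewrite /gram big_map big_enum. Qed.

(** The normalizations of the mean and of the second moment leave one factor
    n, and turn e into n e for the unnormalized sums. *)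
Lemma regularized_RsquareE x e : (0 < n)%N -> 0 < e ->
  n%:R * regularized_Rsquare x e = row_ridge (n%:R * e) (\matrix_i x i).
Proof.
move=> n0 e0; have n_gt0 : 0 < n%:R :> R by rewrite ltr0n.
have n_neq0 := lt0r_neq0 n_gt0.
have e1 : 0 < n%:R * e by rewrite mulr_gt0.
rewrite /row_ridge /ridge /bilin /regularized_Rsquare.
have := ridge_unit (psd_gram (matrix_rows (\matrix_i x i))) e1.
rewrite gram_rows; under eq_bigr do rewrite rowK.
rewrite (eq_bigr x) => [|i _]; last by rewrite rowK.
set S := \sum_(i < n) _; set y := \sum_(i < n) _ => unitS.
have -> : sample_second_moment x + e%:M = n%:R^-1 *: (S + (n%:R * e)%:M).
  by rewrite scalerDr scale_scalar_mx mulrA mulVf// mul1r.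
rewrite invmxZ; last by rewrite unitmxZ// unitfE invr_eq0.
have yT : (n%:R^-1 *: y)^T = n%:R^-1 *: y^T by rewrite linearZ.
rewrite invrK /sample_mean -/y yT -!(scalemxAl, scalemxAr) !scalerA.
by rewrite [in LHS]mxE; field.
Qed.

Lemma row_ridge_anti M e e' : 0 < e -> e <= e' -> row_ridge e' M <= row_ridge e M.
Proof. by move=> e0 ee'; apply: ridge_anti => //; exact: psd_gram. Qed.

Lemma row_ridge_le M e : 0 < e -> row_ridge e M <= n%:R.
Proof.
move=> e0; rewrite /row_ridge.
have sizeE : size (nseq n (1 : R)) = size (matrix_rows M).
  by rewrite size_nseq size_map size_enum_ord.
have := ridge_le_sqr e0 sizeE.
have -> : \sum_(p <- zip (nseq n (1 : R)) (matrix_rows M)) p.1 *: p.2 = \sum_i row i M.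
  have <- : \sum_(v <- matrix_rows M) v = \sum_i row i M by rewrite big_map big_enum.
  move: sizeE; rewrite size_nseq => ->.
  by elim: (matrix_rows M) => [|v vs IH] /=; rewrite ?big_nil// !big_cons IH scale1r.
by rewrite big_nseq expr1n -[X in iter _ X]/(+%R 1) iter_addr addr0.
Qed.

(** The regularized statistic is monotone in e and at most 1, so the limit
    defining R ^ 2 exists for every sample. *)
Lemma regularized_Rsquare_cvg x : (0 < n)%N ->
  regularized_Rsquare x e @[e --> 0^'+] --> Rsquare x.
Proof.
move=> n0; have n_gt0 : 0 < n%:R :> R by rewrite ltr0n.
apply: nonincreasing_at_right_is_cvgr.
  near=> b => u v; rewrite !in_itv /= => /andP[u0 _] /andP[v0 _] uv.
  rewrite -(ler_pM2l n_gt0) !regularized_RsquareE//.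
  by apply: row_ridge_anti; rewrite ?mulr_gt0// ler_pM2l.
near=> b; exists 1 => _ [u /= + <-]; rewrite in_itv /= => /andP[u0 _].
rewrite -(ler_pM2l n_gt0) mulr1 regularized_RsquareE// row_ridge_le//.
by rewrite mulr_gt0.
Unshelve. all: end_near. Qed.

Lemma measurable_row_ridge_matrix {disp} {T : measurableType disp}
    (h : T -> 'M[R]_(n, d)) e : 0 < e ->
  (forall i j, measurable_fun setT (fun t => h t i j)) ->
  measurable_fun setT (fun t => row_ridge e (h t)).
Proof.
move=> e0 mh; apply: measurable_ridge => //.
- by move=> t; exact: psd_gram.
- move=> i j.
  rewrite (_ : (fun _ => _) = fun t => \sum_k h t k i * h t k j); last first.
    apply/funext => t; rewrite gram_rows summxE; apply: eq_bigr => k _.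
    by rewrite !mxE big_ord1 !mxE.
  by apply: measurable_sum => k; exact: measurable_funM.
- move=> i j; rewrite (_ : (fun _ => _) = fun t => \sum_k h t k j); last first.
    by apply/funext => t; rewrite summxE; apply: eq_bigr => k _; rewrite mxE.
  exact: measurable_sum.
Qed.

End regularized_statistic.

(** * Comparison for a fixed regularization *)

Section regularized_comparison.
Context {R : realType} {n d : nat} {disp : measure_display} {T : measurableType disp}.
Variables (P : probability T R) (X : 'I_n -> {RV P >-> 'rV[R]_d}) (f : R -> R).
Hypotheses (hX : orthant_symmetric X) (hf : C2_up_conv f).
Local Notation F := (sqrt_comp f).
Local Notation C := (chi_smooth (EFin \o F) d 0).

Let measurable_rows {disp1} {T1 : measurableType disp1} (Q : probability T1 R)
    (Y : 'I_n -> {RV Q >-> 'rV[R]_d}) i j :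
  measurable_fun setT (fun t => (\matrix_k Y k t) i j).
Proof.
rewrite (_ : (fun _ => _) = fun t => Y i t ord0 j).
  exact: (measurableT_comp (measurable_matrix_entry ord0 j)).
by apply/funext => t; rewrite mxE.
Qed.

(** The signs have square 1 almost surely, so they do not change the Gram
    matrix: the form is a fixed one, evaluated at a signed sum of fixed
    vectors. *)
Lemma signed_rows_le {disp1} {T1 : measurableType disp1} (Q : probability T1 R)
    (eps : 'I_n -> {RV Q >-> R}) (M : 'M[R]_(n, d)) e : 0 < e ->
  (forall i, fair_sign Q (eps i)) -> mutually_independent Q (fun i => eps i : T1 -> R) ->
  (\int[Q]_t (F (row_ridge e (\matrix_i (eps i t *: row i M))))%:E <= C)%E.
Proof.
move=> e0 eps_sign eps_indep.
have psdS := psd_gram (matrix_rows M).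
pose h y := F (ridge (gram (matrix_rows M)) e y).
have mh : measurable_fun setT h.
  by apply: (measurableT_comp (measurable_sqrt_comp hf)); exact: measurable_row_ridge.
have h0 y : 0 <= h y by exact: sqrt_comp_ge0.
rewrite [leLHS](_ : _ = \int[Q]_t (h (\sum_i eps i t *: row i M))%:E)%E.
  rewrite (expectation_signed_sum eps_sign eps_indep _ mh h0).
  exact: sign_average_ridge_le_chi.
apply: ge0_ae_eq_integral => //.
- apply/measurable_EFinP; apply: (measurableT_comp (measurable_sqrt_comp hf)).
  apply: measurable_row_ridge_matrix => // i j.
  under eq_fun do rewrite !mxE.
  exact: measurable_funM.
- apply/measurable_EFinP; apply: (measurableT_comp mh).
  apply: measurable_fun_matrix => i j; under eq_fun do rewrite summxE.
  by apply: measurable_sum => k; under eq_fun do rewrite !mxE; exact: measurable_funM.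
- by move=> t _; rewrite lee_fin; exact: sqrt_comp_ge0.
- by move=> t _; rewrite lee_fin.
apply: filterS (fair_sign_ae eps_sign) => t sign_t _.
rewrite /h /row_ridge.
have -> : gram (matrix_rows (\matrix_i (eps i t *: row i M))) = gram (matrix_rows M).
  rewrite !gram_rows; apply: eq_bigr => i _; rewrite rowK.
  rewrite [(_ *: _)^T]linearZ /= -scalemxAl -scalemxAr scalerA.
  by case: (sign_t i) => ->; rewrite ?mulrNN mulr1 scale1r.
by under eq_bigr do rewrite rowK.
Qed.

(** The signs are independent of the rows, so the bound [signed_rows_le] for
    fixed rows can be integrated over the law of the rows. *)
Lemma orthant_symmetric_ridge_le e : 0 < e ->
  (\int[P]_w (F (row_ridge e (\matrix_i X i w)))%:E <= C)%E.
Proof.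
move=> e0; have [disp1 [T1 [Q [Y [eps [XY eps_sign eps_indep epsY XepsY]]]]]] := hX.
have mentry i j : measurable_fun setT (fun M : 'M[R]_(n, d) => M i j).
  exact: measurable_matrix_entry.
pose G (M : 'M[R]_(n, d)) := (F (row_ridge e M))%:E.
have mG : measurable_fun setT G.
  apply/measurable_EFinP; apply: (measurableT_comp (measurable_sqrt_comp hf)).
  exact: measurable_row_ridge_matrix.
have G0 M : (0 <= G M)%E by rewrite lee_fin; exact: sqrt_comp_ge0.
have mX : measurable_fun setT (fun w => \matrix_i X i w : 'M[R]_(n, d)).
  by apply: measurable_fun_matrix => i j; exact: measurable_rows.
have mY : measurable_fun setT (fun w => \matrix_i Y i w : 'M[R]_(n, d)).
  by apply: measurable_fun_matrix => i j; exact: measurable_rows.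
have mYij i j : measurable_fun setT (fun t => Y i t ord0 j).
  exact: (measurableT_comp (measurable_matrix_entry ord0 j)).
have mepsY : measurable_fun setT (fun w => \matrix_i (eps i w *: Y i w) : 'M[R]_(n, d)).
  apply: measurable_fun_matrix => i j; under eq_fun do rewrite !mxE.
  exact: measurable_funM.
have meps : measurable_fun setT (fun w => \row_i eps i w : 'rV[R]_n).
  apply: measurable_fun_matrix => i j; under eq_fun do rewrite mxE.
  exact: (measurable_funPT (eps j)).
rewrite (same_law_integral mX mepsY XepsY mG G0).
pose G2 (Mv : 'M[R]_(n, d) * 'rV[R]_n) :=
  G (\matrix_i (Mv.2 ord0 i *: row i Mv.1)).
have mG2 : measurable_fun setT G2.
  apply: (measurableT_comp mG); apply: measurable_fun_matrix => i j.
  under eq_fun do rewrite !mxE.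
  apply: measurable_funM.
    exact: (measurableT_comp (measurable_matrix_entry ord0 i)).
  exact: (measurableT_comp (measurable_matrix_entry i j)).
have G20 z : (0 <= G2 z)%E by exact: G0.
pose rho := finite_pushforward Q meps.
have indep A B : measurable A -> measurable B ->
    Q ((fun w => \matrix_i Y i w) @^-1` A `&` (fun w => \row_i eps i w) @^-1` B) =
    (Q ((fun w => \matrix_i Y i w) @^-1` A) * rho B)%E.
  by move=> mA mB; rewrite setIC epsY// muleC.
rewrite (_ : (\int[Q]_t _)%E = (\int[Q]_t G2 (\matrix_i Y i t, \row_i eps i t))%E).
  rewrite (integral_independent_pair mY meps indep mG2 G20).
  rewrite -[leRHS]mule1 -(probability_setT Q) -(integral_cst Q)//.
  apply: ge0_le_integral => //.
  - by move=> t _; apply: integral_ge0.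
  - have mint := measurable_fun_fubini_tonelli_F (m2 := rho) G2 mG2 G20.
    exact: (measurableT_comp mint mY).
  - move=> t _; rewrite /rho integral_finite_pushforward//; last first.
      by apply: (measurableT_comp mG2); exact: measurable_fun_pair.
    rewrite (_ : (\int[Q]_w _)%E =
      (\int[Q]_w (F (row_ridge e (\matrix_i (eps i w *: row i (\matrix_i Y i t)))))%:E)%E).
      exact: signed_rows_le.
    by apply: eq_integral => w _; rewrite /G2 /G /=; congr (F (row_ridge _ _))%:E;
      apply/matrixP => i j; rewrite !mxE.
by apply: eq_integral => t _; rewrite /G2 /G /=; congr (F (row_ridge _ _))%:E;
  apply/matrixP => i j; rewrite !mxE.
Qed.

End regularized_comparison.

Theorem theorem6p1 (R : realType) (n d : nat) (hn : (1 <= n)%N) (hd : (1 <= d)%N)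
  (disp : measure_display) (T : measurableType disp) (P : probability T R)
  (X : 'I_n -> {RV P >-> 'rV[R]_d}) (hX : orthant_symmetric X)
  (disp' : measure_display) (T' : measurableType disp') (P' : probability T' R)
  (chi2_d : {RV P' >-> R}) (hchi : chi_square d chi2_d)
  (f : R -> R) (hf : C2_up_conv f) :
  ('E_P[fun w => f (Num.sqrt n%:R * Rstat (fun i => X i w))%R]
     <= 'E_P'[fun w => f (Num.sqrt (chi2_d w))%R])%E.
Proof.
have n_gt0 : 0 < n%:R :> R by rewrite ltr0n.
have mF : measurable_fun setT (EFin \o sqrt_comp f).
  by apply/measurable_EFinP; exact: measurable_sqrt_comp.
have F0 s : (0 <= (EFin \o sqrt_comp f) s)%E by rewrite lee_fin sqrt_comp_ge0.
rewrite unlock [leRHS](_ : _ = chi_smooth (EFin \o sqrt_comp f) d 0); last first.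
  exact: (chi_square_integral hchi mF F0).
pose e j : R := j.+1%:R^-1.
have e_gt0 j : 0 < e j by rewrite invr_gt0.
have ne_gt0 j : 0 < n%:R * e j by rewrite mulr_gt0.
have e_cvg : e j @[j --> \oo] --> 0 by exact: cvg_harmonic.
pose g j w := (sqrt_comp f (row_ridge (n%:R * e j) (\matrix_i X i w)))%:E.
have g0 j w : (0 <= g j w)%E by exact: F0.
have mg j : measurable_fun setT (g j).
  apply: (measurableT_comp mF); apply: measurable_row_ridge_matrix => // k l.
  under eq_fun do rewrite mxE.
  exact: (measurableT_comp (measurable_matrix_entry ord0 l)).
have nd_g w : {homo g ^~ w : i j / (i <= j)%N >-> (i <= j)%E}.
  move=> i j ij; rewrite lee_fin; apply: sqrt_comp_homo => //.
  by apply: row_ridge_anti => //; rewrite ler_pM2l// lef_pV2 ?posrE// ler_nat.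
have g_cvg w : g j w @[j --> \oo] -->
    (f (Num.sqrt n%:R * Rstat (fun i => X i w)))%:E.
  have cvg_ridge : row_ridge (n%:R * e j) (\matrix_i X i w) @[j --> \oo] -->
      n%:R * Rsquare (fun i => X i w).
    rewrite (_ : (fun _ => _) = fun j => n%:R * regularized_Rsquare (fun i => X i w) (e j)).
      apply: cvgM; first exact: cvg_cst.
      have /cvg_at_rightP := regularized_Rsquare_cvg (x := fun i => X i w) hn.
      by apply; split.
    by apply/funext => j; rewrite regularized_RsquareE.
  apply/fine_cvgP; split; first by apply: nearW.
  rewrite /Rstat -sqrtrM ?ler0n//.
  exact: (cvg_comp _ _ cvg_ridge (@sqrt_comp_continuous _ _ hf _)).
rewrite (_ : (\int[P]_w _)%E = (\int[P]_w (limn (g ^~ w)))%E); last first.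
  by apply: eq_integral => w _; apply/esym/cvg_lim => //; exact: g_cvg.
rewrite monotone_convergence//.
apply: lime_le.
  apply: ereal_nondecreasing_is_cvgn => i j ij; apply: ge0_le_integral => //.
  by move=> w _; exact: nd_g.
by apply: nearW => j; exact: orthant_symmetric_ridge_le.
Qed.
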